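(* Assume the family $\{f_t\}_t$ is Newton-admissible. Then, in a sufficiently small neighbourhood of the origin, the canonical toric stratification $\mathcal{S}$ of $V(f)$ satisfies Thom's $a_f$ condition: for every stratum $S\in\mathcal{S}$, every point $(\tau,\mathbf{q})\in S$, and every sequence $(\tau_m,\mathbf{q}_m)\notin V(f)$ with $(\tau_m,\mathbf{q}_m)\to(\tau,\mathbf{q})$ and such that the tangent spaces $T_{(\tau_m,\mathbf{q}_m)}V(f-f(\tau_m,\mathbf{q}_m))$ converge to some $T$ (in the appropriate Grassmannian), one has $T_{(\tau,\mathbf{q})}S\subseteq T$.
   Context: Let $(t,\mathbf{z})=(t,z_1,\ldots,z_n)$ be coordinates on $\mathbb{C}\times\mathbb{C}^n$. For $k\in K_0:=\{1,\ldots,k_0\}$ let $f^k\colon\mathbb{C}\times\mathbb{C}^n\to\mathbb{C}$ be a non-constant polynomial with $f^k(t,\mathbf{0})=0$ for all $t$; put $f:=f^1\cdots f^{k_0}$, $f_t(\mathbf{z}):=f(t,\mathbf{z})$, $f^k_t(\mathbf{z}):=f^k(t,\mathbf{z})$. All statements concern germs at the origin; a small representative is chosen so that $0$ is the only possible critical value of $f$, and $V(f-c):=\{(t,\mathbf z): f(t,\mathbf z)=c\}$. Newton data: for a polynomial $g(\mathbf{z})=\sum_\alpha c_\alpha\mathbf{z}^\alpha$ with $g(\mathbf{0})=0$, $\Gamma_+(g)$ is the convex hull in $\mathbb{R}^n_+$ of $\bigcup_{c_\alpha\neq0}(\alpha+\mathbb{R}^n_+)$, and the Newton boundary $\Gamma(g)$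 is the union of its compact faces. For a weight vector $\mathbf{w}=(w_1,\ldots,w_n)\in\mathbb{N}^n\setminus\{\mathbf{0}\}$ (nonnegative integers), $d(\mathbf{w};g):=\min\{\sum_i w_ix_i : x\in\Gamma_+(g)\}$, $\Delta(\mathbf{w};g)$ is the face of $\Gamma_+(g)$ where this minimum is attained, $g_{\mathbf{w}}:=\sum_{\alpha\in\Delta(\mathbf{w};g)}c_\alpha\mathbf{z}^\alpha$ is the face function, and $I(\mathbf{w}):=\{i: w_i=0\}$. $\mathbf w$ is positive if all $w_i>0$. For $I\subseteq\{1,\ldots,n\}$, $\mathbb{C}^I:=\{\mathbf{z}: z_i=0 \text{ for } i\notin I\}$ and $\mathbb{C}^{*I}:=\{\mathbf{z}: z_i=0\iff i\notin I\}$; $\mathbb{C}^{*n}=\mathbb{C}^{*\{1,\ldots,n\}}$. $\mathcal{V}_g$ is the set of $I$ with $g|_{\mathbb{C}^I}\equiv0$. For $i_1,\ldots,i_m$ and $u_{i_j}\in\mathbb{C}^*$, $\mathbb{C}^{*n}(u_{i_1},\ldots,u_{i_m}):=\{\mathbf{z}\in\mathbb{C}^{*n}: z_{i_j}=u_{i_j},\ 1\le j\le m\}$. Non-degenerate complete intersection: polynomials $g^1,\ldots,g^p$ vanishing at $\mathbf 0$ define a non-degenerate complete intersection germ $V(g^1,\ldots,g^p)$ if for every positive weight vector $\mathbf{w}$, the $p$-form $dg^1_{\mathbf{w}}\wedge\cdots\wedge dg^p_{\mathbf{w}}$ is nowhere zero on $V^*(g^1_{\mathbf{w}},\ldots,g^p_{\mathbf{w}}):=\{\mathbf{z}\in\mathbb{C}^{*n}: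 g^1_{\mathbf{w}}(\mathbf{z})=\cdots=g^p_{\mathbf{w}}(\mathbf{z})=0\}$. Local tameness: $R>0$ is a radius of local tameness of $\{g^1,\ldots,g^p\}$ if for every nonempty $I=\{i_1,\ldots,i_m\}\in\mathcal{V}_{g^1}\cap\cdots\cap\mathcal{V}_{g^p}$, every $\mathbf{w}\in\mathbb{N}^n\setminus\{\mathbf 0\}$ with $I(\mathbf{w})=I$ and every $u_{i_1},\ldots,u_{i_m}\in\mathbb{C}^*$ with $\sum_j|u_{i_j}|^2<R$, the set $V^*(g^1_{\mathbf{w}},\ldots,g^p_{\mathbf{w}})\cap\mathbb{C}^{*n}(u_{i_1},\ldots,u_{i_m})$ is a reduced non-singular complete intersection in $\mathbb{C}^{*n}(u_{i_1},\ldots,u_{i_m})$, i.e. the differentials of $g^1_{\mathbf{w}},\ldots,g^p_{\mathbf{w}}$ with respect to the variables $(z_i)_{i\notin I}$ are linearly independent at each of its points; the germ is locally tame if such $R$ exists. Newton-admissible: $\{f_t\}_t$ is Newton-admissible if there is $R>0$ such that for all sufficiently small $t$: (i) for each $k\in K_0$, $\Gamma(f^k_t)$ is independent of $t$; (ii) for every nonempty $\{k_1,\ldots,k_p\}\subseteq K_0$, $V(f^{k_1}_t,\ldots,f^{k_p}_t)$ is a non-degenerate, locally tame complete intersection germ having a radius of local tameness greater than $R$ ($R$ independent of $t$ and of the subset). Canonical toric stratification: $\mathcal{S}$ is the collection of nonempty sets $S^I(K):=\{(t,\mathbf{z})\in\mathbb{C}\times\mathbb{C}^{*I}: f^k(t,\mathbf{z})=0\iff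 k\in K\}$ for $I\subseteq\{1,\ldots,n\}$, $K\subseteq K_0$ (near the origin these are non-singular, and $S^{\emptyset}(K_0)=\mathbb{C}\times\{\mathbf 0\}$). *)

(* Defs.v *)
(* complex numbers R[i] over an abstract R : realType
   (mathcomp-real-closed "complex"), polynomials in (t, z_1..z_n) encoded as
   {mpoly {poly R[i]}[n]} (polynomials in z with coefficients in C[t]). *)
From HB Require Import structures.
From mathcomp Require Import all_boot all_order all_algebra.
From mathcomp Require Import reals.
From mathcomp Require Import complex.
From mathcomp Require Import mpoly.
From Stdlib Require Import ClassicalEpsilon.
Set Implicit Arguments. Unset Strict Implicit. Unset Printing Implicit Defensive.
Import Order.TTheory GRing.Theory Num.Theory.
Local Open Scope ring_scope.

Definition cn2 {R : realType} (x : R[i]) : R :=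
  complex.Re x ^+ 2 + complex.Im x ^+ 2.

(* points (and tangent vectors / covectors) of C x C^n *)
Definition pt (R : realType) (n : nat) := (R[i] * ('I_n -> R[i]))%type.

Definition pt0 {R : realType} {n : nat} : pt R n := (0, fun _ => 0).
Definition pt_sub {R : realType} {n : nat} (x y : pt R n) : pt R n :=
  (x.1 - y.1, fun i => x.2 i - y.2 i).
Definition pt_scale {R : realType} {n : nat} (c : R[i]) (x : pt R n) : pt R n :=
  (c * x.1, fun i => c * x.2 i).
Definition pt_pair {R : realType} {n : nat} (a v : pt R n) : R[i] :=
  a.1 * v.1 + \sum_(i < n) a.2 i * v.2 i.
Definition dist2 {R : realType} {n : nat} (x y : pt R n) : R :=
  cn2 (x.1 - y.1) + \sum_(i < n) cn2 (x.2 i - y.2 i).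
Definition norm2 {R : realType} {n : nat} (x : pt R n) : R := dist2 x pt0.

Definition cvg_pt {R : realType} {n : nat} (x : nat -> pt R n) (p : pt R n) : Prop :=
  forall e : R, 0 < e -> exists N : nat, forall m : nat, (N <= m)%N -> dist2 (x m) p < e.

Definition fiberp {R : realType} {n : nat} (F : {mpoly {poly R[i]}[n]}) (t : R[i])
  : {mpoly R[i][n]} := map_mpoly (fun q : {poly R[i]} => q.[t]) F.

Definition evalF {R : realType} {n : nat} (F : {mpoly {poly R[i]}[n]}) (x : pt R n)
  : R[i] := (fiberp F x.1).@[x.2].

Definition gradF {R : realType} {n : nat} (F : {mpoly {poly R[i]}[n]}) (x : pt R n)
  : pt R n :=
  (evalF (map_mpoly (fun q : {poly R[i]} => q^`()) F) x,
   fun i => evalF (mderiv i F) x).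

Definition tangent_space {R : realType} {n : nat} (S : pt R n -> Prop) (p v : pt R n)
  : Prop :=
  exists (x : nat -> pt R n) (c : nat -> R[i]),
    (forall m, S (x m)) /\ cvg_pt x p /\
    cvg_pt (fun m => pt_scale (c m) (pt_sub (x m) p)) v.

(* The hyperplanes T_{x_m} V(F - F(x_m)) = ker dF(x_m) converge to T in the
   Grassmannian of hyperplanes (= dual projective space): the lines spanned by
   dF(x_m) converge to the line spanned by a nonzero covector a, and T = ker a. *)
Definition level_tangents_cvg {R : realType} {n : nat} (F : {mpoly {poly R[i]}[n]})
  (x : nat -> pt R n) (T : pt R n -> Prop) : Prop :=
  exists a : pt R n, a <> pt0 /\
    (exists lam : nat -> R[i], cvg_pt (fun m => pt_scale (lam m) (gradF F (x m))) a) /\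
    (forall v, T v <-> pt_pair a v = 0).

Definition stratum {R : realType} {n k0 : nat} (f : 'I_k0 -> {mpoly {poly R[i]}[n]})
  (I : {set 'I_n}) (K : {set 'I_k0}) (x : pt R n) : Prop :=
  (forall i, x.2 i = 0 <-> i \notin I) /\
  (forall k, evalF (f k) x = 0 <-> k \in K).

Definition Gamma_plus {R : realType} {n : nat} (g : {mpoly R[i][n]}) (x : 'I_n -> R)
  : Prop :=
  exists (N : nat) (a : 'I_N -> 'X_{1..n}) (r : 'I_N -> 'I_n -> R) (lam : 'I_N -> R),
    (forall j, a j \in msupp g) /\ (forall j i, 0 <= r j i) /\
    (forall j, 0 <= lam j) /\ \sum_(j < N) lam j = 1 /\
    (forall i, x i = \sum_(j < N) lam j * ((a j i)%:R + r j i)).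

Definition wdot {R : realType} {n : nat} (w x : 'I_n -> R) : R :=
  \sum_(i < n) w i * x i.

Definition Delta {R : realType} {n : nat} (w : 'I_n -> R) (g : {mpoly R[i][n]})
  (x : 'I_n -> R) : Prop :=
  Gamma_plus g x /\ forall y, Gamma_plus g y -> wdot w x <= wdot w y.

(* Newton boundary Gamma(g): union of the compact faces of Gamma_+(g)
   (faces of Gamma_+(g) are the Delta(w; g) with w real and >= 0) *)
Definition newton_boundary {R : realType} {n : nat} (g : {mpoly R[i][n]})
  (x : 'I_n -> R) : Prop :=
  exists w : 'I_n -> R, (forall i, 0 <= w i) /\
    (exists M : R, forall y, Delta w g y -> forall i, `|y i| <= M) /\
    Delta w g x.

Definition nat_weight {R : realType} {n : nat} (w : 'I_n -> nat) : 'I_n -> R :=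
  fun i => (w i)%:R.
Definition mnm_real {R : realType} {n : nat} (m : 'X_{1..n}) : 'I_n -> R :=
  fun i => (m i)%:R.

Definition face_fun {R : realType} {n : nat} (w : 'I_n -> nat) (g : {mpoly R[i][n]})
  : {mpoly R[i][n]} :=
  \sum_(m <- msupp g)
     (if excluded_middle_informative (Delta (nat_weight w) g (mnm_real m))
      then g@_m *: 'X_[m] else 0).

Definition jac {R : realType} {n : nat} (gs : seq {mpoly R[i][n]}) (z : 'I_n -> R[i])
  : 'M[R[i]]_(size gs, n) :=
  \matrix_(j < size gs, i < n) (mderiv i gs`_j).@[z].

Definition jac_restr {R : realType} {n : nat} (gs : seq {mpoly R[i][n]})
  (I : {set 'I_n}) (z : 'I_n -> R[i]) : 'M[R[i]]_(size gs, n) :=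
  \matrix_(j < size gs, i < n) (if i \in I then 0 else (mderiv i gs`_j).@[z]).

Definition in_torus {R : realType} {n : nat} (z : 'I_n -> R[i]) : Prop :=
  forall i, z i <> 0.

Definition vanishes_on_coord {R : realType} {n : nat} (g : {mpoly R[i][n]})
  (I : {set 'I_n}) : Prop :=
  forall z : 'I_n -> R[i], (forall i, i \notin I -> z i = 0) -> g.@[z] = 0.

(* V(g^1,...,g^p) is a non-degenerate complete intersection germ:
   dg^1_w /\ ... /\ dg^p_w nowhere zero on V^*(g^1_w,...,g^p_w) for w positive *)
Definition nondegenerate_ci {R : realType} {n : nat} (gs : seq {mpoly R[i][n]}) : Prop :=
  forall w : 'I_n -> nat, (forall i, (0 < w i)%N) ->
  forall z : 'I_n -> R[i], in_torus z ->
    (forall j, (j < size gs)%N -> (face_fun w gs`_j).@[z] = 0) ->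
    row_free (jac [seq face_fun w g | g <- gs] z).

Definition tame_radius {R : realType} {n : nat} (gs : seq {mpoly R[i][n]}) (Rr : R)
  : Prop :=
  forall I : {set 'I_n}, I != set0 ->
  (forall j, (j < size gs)%N -> vanishes_on_coord gs`_j I) ->
  forall w : 'I_n -> nat, (exists i, w i <> 0%N) ->
  (forall i, w i = 0%N <-> i \in I) ->
  forall z : 'I_n -> R[i], in_torus z ->
    \sum_(i in I) cn2 (z i) < Rr ->
    (forall j, (j < size gs)%N -> (face_fun w gs`_j).@[z] = 0) ->
    row_free (jac_restr [seq face_fun w g | g <- gs] I z).

Definition newton_admissible {R : realType} {n k0 : nat}
  (f : 'I_k0 -> {mpoly {poly R[i]}[n]}) : Prop :=
  exists Rr : R, 0 < Rr /\
  exists delta : R, 0 < delta /\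
    (forall (k : 'I_k0) (t t' : R[i]), cn2 t < delta -> cn2 t' < delta ->
       forall x, newton_boundary (fiberp (f k) t) x <->
                 newton_boundary (fiberp (f k) t') x) /\
    (forall t : R[i], cn2 t < delta ->
     forall K : {set 'I_k0}, K != set0 ->
       nondegenerate_ci [seq fiberp (f k) t | k <- enum K] /\
       exists R' : R, Rr < R' /\ tame_radius [seq fiberp (f k) t | k <- enum K] R').

(* Main.v *)
(* The limit of the conormal covectors is computed along an ultrafilter, instead of
   along a real-analytic arc.  If (t_m, z_m) tends to (tau, q), the moduli of the
   monomials z_m^alpha are totally preordered along the ultrafilter, and Gordan's
   alternative realises this preorder, on the finitely many exponents involved, by
   a weight vector w with I(w) = {i : q_i <> 0}; projecting the logarithms of the
   moduli gives a torus point zt with lim z_m^(alpha - beta) = zt^(alpha - beta)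
   whenever w.alpha = w.beta.  So f^k(t_m, z_m) behaves like the value at zt of the
   face function f^k_(tau,w), as do its logarithmic derivatives in z.  Constancy of
   the Newton boundaries makes the t-derivative of no larger order.

   Write lam df = sum_k mu_k df^k with mu_k f^k independent of k, and rescale the
   mu_k by the size of f^k.  Comparing with the rows z_i d/dz_i, i notin I(w), and
   using Euler's identity, the limits nu_k satisfy nu_k f^k_w(zt) = 0 and a linear
   relation between the differentials of the f^k_w in the variables outside I(w).
   Non-degeneracy or local tameness kills nu_k whenever f^k vanishes on C^(I(w)), so
   the limit covector is, in the variables t and z_i (i in I(w)), a combination of
   the df^k(tau, q) with f^k(tau, q) = 0, and these annihilate the tangent space of
   the stratum.  The nu_k stay bounded because those differentials are independent
   near the origin, which is the same argument for points tending to the origin. *)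
Require Import Defs.
From HB Require Import structures.
From mathcomp Require Import all_boot all_order all_algebra.
From mathcomp Require Import reals boolp.
From mathcomp Require classical_sets sequences exp filter.
From mathcomp Require Import complex.
From mathcomp Require Import mpoly.
From mathcomp Require Import ring lra.
Import Order.TTheory GRing.Theory Num.Theory.
Local Open Scope ring_scope.

(** * Limits along an ultrafilter *)

(** The field [ultra_ge] puts every tail in [U], so ordinary convergence of a sequence implies
    convergence along [U]. *)
Record ultra (U : (nat -> Prop) -> Prop) : Prop := Ultra {
  ultraS : forall A B : nat -> Prop, U A -> (forall m, A m -> B m) -> U B;
  ultraI : forall A B : nat -> Prop, U A -> U B -> U (fun m => A m /\ B m);
  ultra_notF : ~ U (fun _ => False);
  ultra_or : forall A : nat -> Prop, U A \/ U (fun m => ~ A m);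
  ultra_ge : forall N, U (fun m => (N <= m)%N) }.

Lemma ultra_exists : exists U, ultra U.
Proof.
have [G [GU sub]] := filter.ultraFilterLemma filter.eventually_filter.
have PG := filter.ultra_proper (UltraFilter := GU).
have FG := filter.filter_filter (ProperFilter := PG).
exists G; split.
- move=> A B GA AB; exact: (filter.filterS (Filter := FG)) GA.
- move=> A B GA GB; exact: (filter.filterI (Filter := FG)).
- exact: (filter.filter_not_empty G (ProperFilter := PG)).
- by move=> A; exact: filter.in_ultra_setVsetC.
- by move=> N; apply: sub; exists N.
Qed.

Section UltraTheory.
Context {U : (nat -> Prop) -> Prop} (uU : ultra U).

Lemma ultraT (A : nat -> Prop) : (forall m, A m) -> U A.
Proof. by move=> h; apply: (ultraS _ uU _ _ (ultra_ge _ uU 0%N)). Qed.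

Lemma ultraS2 (A B C : nat -> Prop) :
  U A -> U B -> (forall m, A m -> B m -> C m) -> U C.
Proof.
by move=> UA UB h; apply: (ultraS _ uU _ _ (ultraI _ uU _ _ UA UB)) => m [? ?]; apply: h.
Qed.

Lemma ultra_ex (A : nat -> Prop) : U A -> exists m, A m.
Proof.
move=> UA; apply: contrapT => nA; apply: (ultra_notF _ uU).
by apply: (ultraS _ uU _ _ UA) => m Am; apply: nA; exists m.
Qed.

Lemma ultra_not (A : nat -> Prop) : ~ U A -> U (fun m => ~ A m).
Proof. by case: (ultra_or _ uU A). Qed.

Lemma ultra_seq (T : eqType) (s : seq T) (A : T -> nat -> Prop) :
  (forall i, i \in s -> U (A i)) -> U (fun m => forall i, i \in s -> A i m).
Proof.
elim: s => [|i s IH] h; first exact: ultraT.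
apply: (ultraS2 _ _ _ (h i (mem_head _ _)) (IH _)).
  by move=> j js; apply: h; rewrite in_cons js orbT.
by move=> m Ai As j; rewrite in_cons => /orP[/eqP->//|/As].
Qed.

Lemma ultra_fin (T : finType) (A : T -> nat -> Prop) :
  (forall i, U (A i)) -> U (fun m => forall i, A i m).
Proof.
move=> h; apply: (ultraS _ uU _ _ (ultra_seq _ (enum T) A (fun i _ => h i))).
by move=> m hm i; apply: hm; rewrite mem_enum.
Qed.

(** Finite pigeonhole: if every [A i] failed on a large set, the finitely many failures would hold
    together. It freezes discrete data varying with [m], such as the set of vanishing coordinates or
    the index of the largest coefficient. *)
Lemma ultra_pick (T : finType) (A : T -> nat -> Prop) :
  U (fun m => exists i, A i m) -> exists i, U (A i).
Proof.
move=> h; apply: contrapT => nA; apply: (ultra_notF _ uU).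
have /ultra_fin h' : forall i, U (fun m => ~ A i m).
  by move=> i; apply: ultra_not => UA; apply: nA; exists i.
by apply: (ultraS2 _ _ _ h h') => m [i Ai] /(_ i).
Qed.

End UltraTheory.

(** The limit is the supremum of the [x] with [x <= u m] for [U]-most [m]. Just below it some such
    [x] exists; just above it the bound fails, and the ultrafilter turns this failure into the
    opposite inequality on a large set. *)
Lemma bounded_ultra_lim {R : realType} {U} (uU : ultra U) (u : nat -> R) (M : R) :
  U (fun m => `|u m| <= M) ->
  exists l, forall e, 0 < e -> U (fun m => `|u m - l| < e).
Proof.
move=> bu.
pose E : classical_sets.set R := fun x : R => U (fun m => x <= u m).
have E0 : E (- M).
  by apply: (ultraS _ uU _ _ bu) => m; rewrite ler_norml => /andP[].
have EM x : E x -> x <= M.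
  move=> Ex; have [m []] := ultra_ex uU _ (ultraI _ uU _ _ Ex bu).
  by rewrite ler_norml => + /andP[_]; exact: le_trans.
have supE : classical_sets.has_sup E by split; [exists (- M) | exists M].
exists (sup E) => e e0.
have [x Ex xs] := sup_adherent e0 supE.
have nE : ~ E (sup E + e).
  by move=> /(sup_upper_bound supE); rewrite gerDl leNgt e0.
have nE' : U (fun m => ~ (sup E + e <= u m)) := ultra_not uU _ nE.
apply: (ultraS2 uU (fun m => x <= u m) _ _ Ex nE') => m h1 /negP h2.
rewrite -ltNge in h2.
by rewrite ltr_norml; apply/andP; split; lra.
Qed.

(** * The squared modulus *)

Section Cn2.
Context {R : realType}.
Implicit Types x y : R[i].

Lemma cn2_ge0 x : 0 <= cn2 x.
Proof. by rewrite addr_ge0 ?sqr_ge0. Qed.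

Lemma cn20 : cn2 (0 : R[i]) = 0.
Proof. by rewrite /cn2 /= expr0n addr0. Qed.

Lemma cn2_eq0 x : (cn2 x == 0) = (x == 0).
Proof.
by case: x => a b; rewrite /cn2 /= paddr_eq0 ?sqr_ge0 // !sqrf_eq0 eq_complex.
Qed.

Lemma cn2_gt0 x : x != 0 -> 0 < cn2 x.
Proof. by rewrite lt0r cn2_eq0 cn2_ge0 andbT. Qed.

Lemma cn2M x y : cn2 (x * y) = cn2 x * cn2 y.
Proof. by case: x y => a b [c d]; rewrite /cn2 /=; ring. Qed.

Lemma cn21 : cn2 (1 : R[i]) = 1.
Proof. by rewrite /cn2 /= expr0n addr0 expr1n. Qed.

Lemma cn2N x : cn2 (- x) = cn2 x.
Proof. by case: x => a b; rewrite /cn2 /= !sqrrN. Qed.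

Lemma cn2V x : cn2 x^-1 = (cn2 x)^-1.
Proof.
have [->|x0] := eqVneq x 0; first by rewrite invr0 cn20 invr0.
have h : cn2 x * cn2 x^-1 = 1 by rewrite -cn2M divff // cn21.
by apply: (mulfI (x := cn2 x)); rewrite ?cn2_eq0 // h divff // cn2_eq0.
Qed.

(** The difference of the two sides is [cn2 (x - y)]. This replaces the triangle inequality, which
    squared moduli do not satisfy. *)
Lemma cn2D x y : cn2 (x + y) <= 2 * cn2 x + 2 * cn2 y.
Proof.
case: x y => a b [c d]; rewrite /cn2 /=.
have := sqr_ge0 (a - c); have := sqr_ge0 (b - d); lra.
Qed.

Lemma cn2X x k : cn2 (x ^+ k) = cn2 x ^+ k.
Proof. by elim: k => [|k IH]; rewrite ?expr0 ?cn21 // !exprS cn2M IH. Qed.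

Lemma cn2_prod (I : Type) (r : seq I) (F : I -> R[i]) :
  cn2 (\prod_(i <- r) F i) = \prod_(i <- r) cn2 (F i).
Proof.
by elim: r => [|i r IH]; rewrite ?big_nil ?cn21 // !big_cons cn2M IH.
Qed.

Lemma cn2_real (a : R) : cn2 a%:C%C = a ^+ 2.
Proof. by rewrite /cn2 /= expr0n addr0. Qed.
End Cn2.

(** * Calculus of complex limits along an ultrafilter *)

Definition ulim {R : realType} (U : (nat -> Prop) -> Prop) (x : nat -> R[i]) (l : R[i]) :=
  forall e : R, 0 < e -> U (fun m => cn2 (x m - l) < e).

Section Ulim.
Context {R : realType} {U : (nat -> Prop) -> Prop} (uU : ultra U).
Implicit Types (x y : nat -> R[i]) (l : R[i]).

Lemma ulim_cst l : ulim U (fun _ => l) l.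
Proof. by move=> e e0; apply: (ultraT uU) => m; rewrite subrr cn20. Qed.

Lemma ulim_near x y l : U (fun m => x m = y m) -> ulim U x l -> ulim U y l.
Proof.
by move=> xy xl e e0; apply: (ultraS2 uU _ _ _ xy (xl _ e0)) => m <-.
Qed.

Lemma ulim_ext x y l : (forall m, x m = y m) -> ulim U x l -> ulim U y l.
Proof. by move=> h; apply: ulim_near; apply: (ultraT uU). Qed.

Lemma ulim_bounded x l : ulim U x l -> exists2 M, 0 < M & U (fun m => cn2 (x m) <= M).
Proof.
move=> xl; exists (2 + 2 * cn2 l); first by have := cn2_ge0 l; lra.
apply: (ultraS _ uU _ _ (xl 1 ltr01)) => m h.
by rewrite -[x m](subrK l); have := cn2D (x m - l) l; lra.
Qed.

Lemma ulim_add x y l l' :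
  ulim U x l -> ulim U y l' -> ulim U (fun m => x m + y m) (l + l').
Proof.
move=> xl yl e e0; have e4 : 0 < e / 4 by lra.
apply: (ultraS2 uU _ _ _ (xl _ e4) (yl _ e4)) => m h1 h2.
have -> : x m + y m - (l + l') = (x m - l) + (y m - l') by ring.
by have := cn2D (x m - l) (y m - l'); lra.
Qed.

Lemma ulim0_mulb x y M :
  ulim U x 0 -> U (fun m => cn2 (y m) <= M) -> ulim U (fun m => x m * y m) 0.
Proof.
move=> xl yM e e0.
have M0 : 0 < `|M| + 1 by have := normr_ge0 M; lra.
have eM : 0 < e / (`|M| + 1) by rewrite divr_gt0.
apply: (ultraS2 uU _ _ _ (xl _ eM) yM) => m; rewrite !subr0 cn2M ltr_pdivlMr // => h1 h2.
have hM : cn2 (y m) <= `|M| + 1 by have := ler_norm M; lra.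
by apply: le_lt_trans h1; rewrite ler_wpM2l ?cn2_ge0.
Qed.

Lemma ulim_subl x l : ulim U x l <-> ulim U (fun m => x m - l) 0.
Proof. by split=> h e e0; apply: (ultraS _ uU _ _ (h e e0)) => m; rewrite subr0. Qed.

Lemma ulim_mul x y l l' :
  ulim U x l -> ulim U y l' -> ulim U (fun m => x m * y m) (l * l').
Proof.
move=> xl yl; apply/ulim_subl; have [M _ yM] := ulim_bounded _ _ yl.
have h1 := ulim0_mulb _ _ _ ((ulim_subl x l).1 xl) yM.
have h2 := ulim0_mulb _ _ (cn2 l) ((ulim_subl y l').1 yl)
  (ultraT uU (fun=> cn2 l <= cn2 l) (fun _ => lexx _)).
have := ulim_add _ _ _ _ h1 h2; rewrite addr0; apply: ulim_ext => m; ring.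
Qed.

Lemma ulim_mulc x l c : ulim U x l -> ulim U (fun m => c * x m) (c * l).
Proof. exact: ulim_mul (ulim_cst c). Qed.

Lemma ulim_sum (I : eqType) (r : seq I) (x : I -> nat -> R[i]) (l : I -> R[i]) :
  (forall i, i \in r -> ulim U (x i) (l i)) ->
  ulim U (fun m => \sum_(i <- r) x i m) (\sum_(i <- r) l i).
Proof.
elim: r => [|i r IH] h.
  by rewrite big_nil; apply: (ulim_ext _ _ _ _ (ulim_cst 0)) => m; rewrite big_nil.
have h1 := ulim_add _ _ _ _ (h i (mem_head _ _))
  (IH (fun j jr => h j (mem_behead (s := i :: r) jr))).
by rewrite big_cons; apply: (ulim_ext _ _ _ _ h1) => m; rewrite big_cons.
Qed.

Lemma ulim_prod (I : eqType) (r : seq I) (x : I -> nat -> R[i]) (l : I -> R[i]) :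
  (forall i, i \in r -> ulim U (x i) (l i)) ->
  ulim U (fun m => \prod_(i <- r) x i m) (\prod_(i <- r) l i).
Proof.
elim: r => [|i r IH] h.
  by rewrite big_nil; apply: (ulim_ext _ _ _ _ (ulim_cst 1)) => m; rewrite big_nil.
have h1 := ulim_mul _ _ _ _ (h i (mem_head _ _))
  (IH (fun j jr => h j (mem_behead (s := i :: r) jr))).
by rewrite big_cons; apply: (ulim_ext _ _ _ _ h1) => m; rewrite big_cons.
Qed.

Lemma ulim_exp x l k : ulim U x l -> ulim U (fun m => x m ^+ k) (l ^+ k).
Proof.
move=> h; elim: k => [|k IH]; first by rewrite expr0; exact: (ulim_ext _ _ _ _ (ulim_cst 1)).
by rewrite exprS; apply: (ulim_ext _ _ _ _ (ulim_mul _ _ _ _ h IH)) => m; rewrite exprS.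
Qed.

Lemma ulim_uniq x l l' : ulim U x l -> ulim U x l' -> l = l'.
Proof.
move=> h1 h2; apply/eqP; rewrite -subr_eq0 -cn2_eq0; apply: contrapT => /negP h.
have e0 : 0 < cn2 (l - l') / 4 by have := cn2_ge0 (l - l'); lra.
have [m []] := ultra_ex uU _ (ultraI _ uU _ _ (h1 _ e0) (h2 _ e0)).
have -> : l - l' = - (x m - l) + (x m - l') by ring.
by have := cn2D (- (x m - l)) (x m - l'); rewrite cn2N; lra.
Qed.

(** By [cn2D], [cn2 l] is at most twice [cn2 (x m - l)] plus twice [cn2 (x m)]; once the first
    summand is below half of [cn2 l], the bound with 1/4 remains. *)
Lemma ulim_gt x l : l != 0 -> ulim U x l -> U (fun m => cn2 l / 4 < cn2 (x m)).
Proof.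
move=> l0 xl; have c0 := cn2_gt0 _ l0; have e0 : 0 < cn2 l / 4 by lra.
apply: (ultraS _ uU _ _ (xl _ e0)) => m h.
have := cn2D (- (x m - l)) (x m); rewrite cn2N.
have -> : - (x m - l) + x m = l by ring.
by lra.
Qed.

Lemma ulim_neq0 x l : l != 0 -> ulim U x l -> U (fun m => x m != 0).
Proof.
move=> l0 xl; apply: (ultraS _ uU _ _ (ulim_gt _ _ l0 xl)) => m.
apply: contraTneq => ->; rewrite cn20 -leNgt.
by have := cn2_ge0 l; lra.
Qed.

Lemma ulim_inv x l : l != 0 -> ulim U x l -> ulim U (fun m => (x m)^-1) l^-1.
Proof.
move=> l0 xl; apply/ulim_subl.
have h1 := (ulim_subl x l).1 xl.
(* The difference of inverses is [x m - l] times [- (x m * l)^-1]; the second factor is bounded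
   because [x m] stays away from 0. *)
have b : U (fun m => cn2 (- (x m * l)^-1) <= (cn2 l / 4 * cn2 l)^-1).
  apply: (ultraS _ uU _ _ (ulim_gt _ _ l0 xl)) => m h.
  have c0 := cn2_gt0 _ l0.
  rewrite cn2N cn2V cn2M lef_pV2 ?posrE ?mulr_gt0 //; try by lra.
  by rewrite ler_wpM2r ?cn2_ge0 // ltW.
apply: (ulim_near _ _ _ _ (ulim0_mulb _ _ _ h1 b)).
apply: (ultraS _ uU _ _ (ulim_neq0 _ _ l0 xl)) => m x0.
by field; rewrite x0 l0.
Qed.

Lemma ulim_div x y l l' : l' != 0 ->
  ulim U x l -> ulim U y l' -> ulim U (fun m => x m / y m) (l / l').
Proof. by move=> l0 xl yl; apply: ulim_mul => //; apply: ulim_inv. Qed.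

Lemma ulim_exists x M : U (fun m => cn2 (x m) <= M) -> exists l, ulim U x l.
Proof.
move=> xM.
have sq (a b : R) : a ^+ 2 + b ^+ 2 <= M -> `|a| <= `|M| + 1 /\ `|b| <= `|M| + 1.
  move=> h; have h1 := ler_norm M; have h2 := normr_ge0 M.
  rewrite !ler_norml.
  have := sqr_ge0 a; have := sqr_ge0 b.
  have := sqr_ge0 (a - 1); have := sqr_ge0 (a + 1).
  have := sqr_ge0 (b - 1); have := sqr_ge0 (b + 1).
  by move=> *; split; apply/andP; split; nra.
have [|a ha] := bounded_ultra_lim uU (fun m => complex.Re (x m)) (`|M| + 1).
  by apply: (ultraS _ uU _ _ xM) => m /sq[].
have [|b hb] := bounded_ultra_lim uU (fun m => complex.Im (x m)) (`|M| + 1).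
  by apply: (ultraS _ uU _ _ xM) => m /sq[].
exists (a +i* b)%C => e e0.
(* Since [d <= 1], the squares of the real and imaginary errors are below [d], and their sum is
   below [e / 2]. *)
pose d := Num.min 1 (e / 4).
have d0 : 0 < d by rewrite lt_min ltr01 /=; lra.
have d1 : d <= 1 by rewrite ge_min lexx.
have d2 : d <= e / 4 by rewrite ge_min lexx orbT.
apply: (ultraS2 uU _ _ _ (ha _ d0) (hb _ d0)) => m.
case: (x m) => p q /=; rewrite /cn2 /= -[(p - a) ^+ 2]real_normK ?num_real //.
rewrite -[(q - b) ^+ 2]real_normK ?num_real //.
have := normr_ge0 (p - a); have := normr_ge0 (q - b).
move: `|p - a| `|q - b| => A B ? ? ? ?; nra.
Qed.

Lemma ulim_horner (q : {poly R[i]}) x l :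
  ulim U x l -> ulim U (fun m => q.[x m]) q.[l].
Proof.
move=> xl; rewrite horner_coef -(big_mkord xpredT (fun i => q`_i * l ^+ i)).
have h := ulim_sum _ (index_iota 0 (size q)) (fun i m => q`_i * x m ^+ i)
  (fun i => q`_i * l ^+ i) (fun i _ => ulim_mulc _ _ q`_i (ulim_exp _ _ i xl)).
by apply: (ulim_ext _ _ _ _ h) => m; rewrite horner_coef big_mkord.
Qed.

End Ulim.

(** * Gordan's alternative and rational weights *)

(** The one-variable step of Fourier-Motzkin elimination. The order is dense and has no end points,
    so either list may be empty. *)
Lemma exists_between {F : realFieldType} (L V : seq F) :
  (forall l v, l \in L -> v \in V -> l < v) ->
  exists x, (forall l, l \in L -> l < x) /\ (forall v, v \in V -> x < v).
Proof.
have below l (W : seq F) : (forall v, v \in W -> l < v) ->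
    exists2 x, l < x & forall v, v \in W -> x < v.
  elim: W => [|v W IH] h; first by exists (l + 1) => //; lra.
  have [|x lx xW] := IH; first by move=> v' v'W; apply: h; rewrite in_cons v'W orbT.
  have lv := h v (mem_head _ _).
  exists (Num.min x ((l + v) / 2)); first by rewrite lt_min lx /=; lra.
  move=> v'; rewrite in_cons => /orP[/eqP->|/xW v'x].
    by rewrite gt_min; apply/orP; right; lra.
  by rewrite gt_min v'x.
elim: L => [|l L IH] h.
  have [l lV] : exists l, forall v, v \in V -> l < v.
    elim: V {h} => [|v V [l lV]]; first by exists 0.
    exists (Num.min l (v - 1)) => v'; rewrite in_cons => /orP[/eqP->|/lV h].
      by rewrite gt_min; apply/orP; right; lra.
    by rewrite gt_min h.
  by exists l.
have [|x [Lx xV]] := IH; first by move=> a v aL; apply: h; rewrite in_cons aL orbT.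
have [lx|xl] := ltP l x.
  by exists x; split=> // a; rewrite in_cons => /orP[/eqP->//|/Lx].
have [|x' lx' x'V] := below l V; first by move=> v; apply: h; exact: mem_head.
exists x'; split=> // a; rewrite in_cons => /orP[/eqP->//|/Lx ax].
exact: lt_trans ax (le_lt_trans xl lx').
Qed.

(* Gordan's alternative; the proof is Fourier-Motzkin elimination, the cone [P]
   standing for the positive combinations produced on the way. *)
Lemma gordan {F : realFieldType} n (P : 'rV[F]_n -> Prop) :
  (forall a b, P a -> P b -> P (a + b)) ->
  (forall c a, 0 < c -> P a -> P (c *: a)) -> ~ P 0 ->
  forall s : seq 'rV[F]_n, (forall a, a \in s -> P a) ->
  exists w : 'cV[F]_n, forall a, a \in s -> 0 < (a *m w) 0 0.
Proof.
elim: n P => [|n IH] P PD PZ P0 s sP.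
  exists 0 => a /sP; suff -> : a = 0 by [].
  by apply/rowP => -[].
pose hd (a : 'rV[F]_n.+1) := a 0 0.
pose tl (a : 'rV[F]_n.+1) : 'rV[F]_n := rsubmx (a : 'rV_(1 + n)).
pose up (b : 'rV[F]_n) : 'rV[F]_n.+1 := row_mx (0 : 'rV_1) b.
have hdE (a : 'rV[F]_n.+1) : lsubmx (a : 'rV_(1 + n)) = (hd a)%:M.
  by apply/rowP => i; rewrite !mxE !ord1 eqxx mulr1n; congr (a _ _); apply: val_inj.
have aE (a : 'rV[F]_n.+1) : hd a = 0 -> a = up (tl a).
  by move=> h; rewrite /up -{1}[a](@hsubmxK _ _ 1 n) hdE h raddf0.
have tlD a b : tl (a + b) = tl a + tl b by rewrite /tl raddfD.
have tlZ c a : tl (c *: a) = c *: tl a by apply/rowP => i; rewrite !mxE.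
(* For [hd a > 0 > hd b] this is a positive combination of [a] and [b] whose first coordinate
   cancels. *)
pose comb a b := hd a *: b + (- hd b) *: a.
pose s1 := [seq tl a | a <- s & hd a == 0].
pose s2 := [seq tl (comb a b) | a <- [seq a <- s | 0 < hd a],
                                b <- [seq b <- s | hd b < 0]].
have [||||w' w'P] := IH (fun b => P (up b)) _ _ _ (s1 ++ s2).
- move=> a b Pa Pb; suff -> : up (a + b) = up a + up b by apply: PD.
  by have := add_row_mx (0 : 'M[F]_(1, 1)) a 0 b; rewrite addr0 => /esym h; exact: h.
- move=> c a c0 Pa; suff -> : up (c *: a) = c *: up a by apply: PZ.
  by have := scale_row_mx c (0 : 'M[F]_(1, 1)) a; rewrite scaler0 => /esym h; exact: h.
- by rewrite /up; move=> h; apply: P0; move: h; rewrite -(@row_mx0 _ 1 1 n).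
- move=> b; rewrite mem_cat => /orP[|].
    by case/mapP => a; rewrite mem_filter => /andP[/eqP a0 /sP Pa] ->; rewrite -aE.
  case/allpairsP => -[a c] /= []; rewrite !mem_filter => /andP[a0 /sP Pa] /andP[c0 /sP Pc] ->.
  rewrite -aE; first by apply: PD; apply: PZ => //; rewrite oppr_gt0.
  by rewrite /comb /hd !mxE; ring.
pose v a := (tl a *m w') 0 0.
have vD c d a b : v (c *: a + d *: b) = c * v a + d * v b.
  by rewrite /v tlD !tlZ mulmxDl -!scalemxAl !mxE.
(* The first coordinate [x] of the solution must satisfy [hd a * x + v a > 0]. This is a lower bound
   on [x] if [hd a > 0] and an upper bound if [hd a < 0]; compatibility of the bounds is positivity
   of [v] on the combinations [comb]. *)
have [|x [xL xV]] := exists_between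
  [seq - v a / hd a | a <- s & 0 < hd a] [seq - v a / hd a | a <- s & hd a < 0].
  move=> l u /mapP[a]; rewrite mem_filter => /andP[a0 sa] -> /mapP[b].
  rewrite mem_filter => /andP[b0 sb] ->.
  have : 0 < v (comb a b).
    apply: w'P; rewrite mem_cat; apply/orP; right.
    by apply/allpairsP; exists (a, b); split; rewrite //= mem_filter ?a0 ?b0.
  rewrite vD => h; rewrite ltr_pdivrMr // mulrAC ltr_ndivlMr //.
  by lra.
exists (col_mx (x%:M : 'cV_1) w') => a sa.
have -> : (a *m (col_mx (x%:M : 'cV_1) w' : 'cV_(1 + n))) 0 0 = hd a * x + v a.
  rewrite -{1}[a](@hsubmxK _ _ 1 n) (mul_row_col (lsubmx (a : 'rV_(1 + n)))) hdE -scalar_mxM.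
  by rewrite !mxE eqxx mulr1n; congr (_ + _); rewrite /v !mxE.
case: (ltgtP (hd a) 0) => ha.
- have /xV : - v a / hd a \in [seq - v a / hd a | a <- s & hd a < 0].
    by apply: (map_f (fun a => - v a / hd a)); rewrite mem_filter ha sa.
  by rewrite ltr_ndivlMr //; lra.
- have /xL : - v a / hd a \in [seq - v a / hd a | a <- s & 0 < hd a].
    by apply: (map_f (fun a => - v a / hd a)); rewrite mem_filter ha sa.
  by rewrite ltr_pdivrMr //; lra.
- rewrite ha mul0r add0r; apply: w'P; rewrite mem_cat.
  by apply/orP; left; apply: map_f; rewrite mem_filter ha eqxx sa.
Qed.

(** When [u] lists the logarithms of the squared moduli of the coordinates, this is the logarithm of
    the squared modulus of the monomial with exponent vector [g]. *)
Definition ratpair {R : realType} {n} (u : 'I_n -> R) (g : 'rV[rat]_n) : R :=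
  \sum_i ratr (g 0 i) * u i.

Section Scales.
Context {R : realType} {U : (nat -> Prop) -> Prop} (uU : ultra U) {n : nat}.
Variable u : nat -> 'I_n -> R.

(** In terms of monomials, [unb g] says that the one with exponent [g] tends to 0, and [bdd g] that
    it stays between two positive constants. *)
Let unb (g : 'rV[rat]_n) := forall M : R, U (fun m => ratpair (u m) g < M).
Let bdd (g : 'rV[rat]_n) := exists M : R, U (fun m => `|ratpair (u m) g| <= M).

Lemma ratpairD (v : 'I_n -> R) g h : ratpair v (g + h) = ratpair v g + ratpair v h.
Proof. by rewrite -big_split; apply: eq_bigr => i _; rewrite mxE rmorphD mulrDl. Qed.

Lemma ratpairZ (v : 'I_n -> R) c g : ratpair v (c *: g) = ratr c * ratpair v g.
Proof. by rewrite mulr_sumr; apply: eq_bigr => i _; rewrite mxE rmorphM mulrA. Qed.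

Lemma ratpairN (v : 'I_n -> R) g : ratpair v (- g) = - ratpair v g.
Proof. by rewrite -scaleN1r ratpairZ rmorphN rmorph1 mulN1r. Qed.

Lemma ratpair_mx (v : 'I_n -> R) g :
  ratpair v g = ((\row_i v i) *m (map_mx ratr g)^T) 0 0.
Proof. by rewrite mxE; apply: eq_bigr => i _; rewrite !mxE mulrC. Qed.

(** The ultrafilter decides every bound. If neither direction is unbounded, one failing bound on
    each side confines the value. This is the total preorder on monomials. *)
Lemma unb_or_bdd g : [\/ unb g, unb (- g) | bdd g].
Proof.
case: (pselect (unb g)) => [|/existsNP[M /(ultra_not uU) h1]]; first exact: Or31.
case: (pselect (unb (- g))) => [|/existsNP[M' /(ultra_not uU) h2]]; first exact: Or32.
apply: Or33; exists (`|M| + `|M'|).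
apply: (ultraS2 uU _ _ _ h1 h2) => m; rewrite ratpairN => /negP + /negP.
rewrite -!leNgt => h3 h4; rewrite ler_norml.
have := ler_norm (- M'); have := ler_norm (- M); rewrite !normrN.
have := normr_ge0 M; have := normr_ge0 M'.
by move=> *; apply/andP; split; lra.
Qed.

Lemma bddD g h : bdd g -> bdd h -> bdd (g + h).
Proof.
move=> [M h1] [M' h2]; exists (M + M'); apply: (ultraS2 uU _ _ _ h1 h2) => m h3 h4.
by rewrite ratpairD; apply: le_trans (ler_normD _ _) _; apply: lerD.
Qed.

Lemma bddZ c g : bdd g -> bdd (c *: g).
Proof.
move=> [M h1]; exists (`|ratr c| * M); apply: (ultraS _ uU _ _ h1) => m h.
by rewrite ratpairZ normrM ler_wpM2l.
Qed.

Lemma bdd0 : bdd 0.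
Proof.
exists 0; apply: (ultraT uU) => m; rewrite normr_le0; apply/eqP.
by apply: big1 => i _; rewrite mxE rmorph0 mul0r.
Qed.

Lemma unb_bdd g : unb g -> bdd g -> False.
Proof.
move=> h [M hM]; have [m []] := ultra_ex uU _ (ultraI _ uU _ _ (h (- M)) hM).
by rewrite ler_norml => h1 /andP[h2 _]; lra.
Qed.

Lemma unbD g h : unb g -> unb h -> unb (g + h).
Proof.
move=> h1 h2 M; apply: (ultraS2 uU _ _ _ (h1 (M / 2)) (h2 (M / 2))) => m.
by rewrite ratpairD; lra.
Qed.

Lemma unbZ c g : 0 < c -> unb g -> unb (c *: g).
Proof.
move=> c0 h M; have rc0 : 0 < ratr c :> R by rewrite ltr0q.
apply: (ultraS _ uU _ _ (h (M / ratr c))) => m.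
by rewrite ratpairZ ltr_pdivlMr // mulrC.
Qed.

(* The exponents [g] with [z^g] bounded away from 0 and infinity span a space on
   which [y] vanishes, where [y] is the projection of the log moduli [u]; the
   other signs are realised by a rational weight through Gordan's alternative. *)
Lemma rational_weight (s : seq 'rV[rat]_n) :
  exists (w : 'cV[rat]_n) (y : nat -> 'I_n -> R),
    (forall i, exists M, U (fun m => `|u m i - y m i| <= M)) /\
    forall g, g \in s ->
      [\/ (g *m w) 0 0 = 0 /\ (forall m, ratpair (y m) g = 0),
          0 < (g *m w) 0 0 /\ unb g | (g *m w) 0 0 < 0 /\ unb (- g)].
Proof.
pose s0 := [seq g <- s | `[< bdd g >]].
pose G : 'M[rat]_(size s0, n) := \matrix_(j < size s0) s0`_j.
have s0b g : g \in s0 -> bdd g by rewrite mem_filter => /andP[/asboolP].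
have Gs g : g \in s0 -> exists j, row j G = g.
  move=> gs; have hj : (index g s0 < size s0)%N by rewrite index_mem.
  by exists (Ordinal hj); rewrite rowK /= nth_index.
have Gb g : (g <= G)%MS -> bdd g.
  case/submxP => h ->; rewrite mulmx_sum_row; apply: big_ind; [exact: bdd0|exact: bddD|].
  by move=> j _; apply: bddZ; apply: s0b; rewrite rowK mem_nth.
(* The product [g *m K^T] represents the class of [g] modulo the row space of [G]. A zero class
   forces [g] to be bounded, which is the hypothesis [~ P 0] of Gordan's alternative for the cone of
   classes of unbounded exponents. *)
pose K := kermx G^T.
have KG g : g *m K^T = 0 -> bdd g.
  move=> gK; apply: Gb; rewrite submxE.
  have : ((cokermx G)^T <= K)%MS.
    by rewrite sub_kermx -trmx_mul mulmx_coker trmx0.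
  case/submxP => D /(congr1 trmx); rewrite trmxK trmx_mul => ->.
  by rewrite mulmxA gK mul0mx.
pose s1 := [seq g <- s | `[< unb g >]] ++ [seq - g | g <- [seq g <- s | `[< unb (- g) >]]].
have s1u g : g \in s1 -> unb g.
  rewrite mem_cat mem_filter => /orP[/andP[/asboolP//]|/mapP[g']].
  by rewrite mem_filter => /andP[/asboolP + _] ->.
have [||||w hw] := @gordan rat n (fun a => exists2 g, unb g & a = g *m K^T) _ _ _
   [seq g *m K^T | g <- s1].
- by move=> a b [g gu ->] [h hu ->]; exists (g + h); [apply: unbD|rewrite mulmxDl].
- by move=> c a c0 [g gu ->]; exists (c *: g); [apply: unbZ|rewrite scalemxAl].
- by move=> [g gu /esym/KG]; apply: unb_bdd.
- by move=> a /mapP[g /s1u gu ->]; exists g.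
(* [H] fixes [GR] on the left, so [y = u - u H] pairs to zero with every row of [G]. The part
   removed is [u GR] times a constant matrix, and the entries of [u GR] are bounded. *)
pose GR := (map_mx (@ratr R) G)^T.
pose H := GR *m pinvmx GR.
have HG : H *m GR = GR by rewrite /H mulmxKpV.
pose ru m := \row_i u m i.
pose y m : 'I_n -> R := fun i => (ru m - ru m *m H) 0 i.
exists (K^T *m w), y; split.
  move=> i.
  have e m : u m i - y m i = ((ru m *m GR) *m pinvmx GR) 0 i.
    by rewrite /y /H mulmxA !mxE; ring.
  have hb j : exists M, U (fun m => `|(ru m *m GR) 0 j| <= M).
    have [|M hM] := s0b s0`_j; first by rewrite mem_nth.
    exists M; apply: (ultraS _ uU _ _ hM) => m; rewrite ratpair_mx.
    suff -> : (ru m *m GR) 0 j = (ru m *m (map_mx ratr s0`_j)^T) 0 0 by [].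
    by rewrite !mxE; apply: eq_bigr => k _; rewrite !mxE.
  have [M hM] := choice hb.
  exists (\sum_j M j * `|pinvmx GR j i|).
  apply: (ultraS _ uU _ _ (ultra_fin uU _ _ hM)) => m h.
  rewrite e mxE; apply: le_trans (ler_norm_sum _ _ _) _.
  by apply: ler_sum => j _; rewrite normrM ler_wpM2r.
move=> g gs; case: (unb_or_bdd g) => hg.
- apply: Or32; split=> //; rewrite mulmxA; apply: hw.
  by apply: map_f; rewrite mem_cat mem_filter gs andbT; apply/orP; left; apply/asboolP.
- apply: Or33; split=> //; rewrite -oppr_gt0.
  have -> : - (g *m (K^T *m w)) 0 0 = ((- g) *m K^T *m w) 0 0.
    by rewrite mulmxA !mulNmx [RHS]mxE.
  apply: hw; apply: map_f; rewrite mem_cat; apply/orP; right.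
  by apply: map_f; rewrite mem_filter gs andbT; apply/asboolP.
- have gs0 : g \in s0 by rewrite mem_filter gs andbT; apply/asboolP.
  have [j gj] := Gs g gs0.
  apply: Or31; split.
    rewrite -gj mulmxA; suff -> : row j G *m K^T = 0 by rewrite mul0mx mxE.
    by rewrite -row_mul -[G]trmxK -trmx_mul mulmx_ker trmx0 row0.
  move=> m; rewrite ratpair_mx.
  have -> : \row_i y m i = ru m - ru m *m H by apply/rowP => i; rewrite mxE.
  have -> : (map_mx ratr g)^T = col j GR.
    by apply/colP => i; rewrite -gj !mxE.
  by rewrite colE mulmxA mulmxBl -mulmxA HG subrr mul0mx mxE.
Qed.
End Scales.

(** * Monomials along a sequence *)

Definition mon {K : comNzRingType} {n} (z : 'I_n -> K) (a : 'X_{1..n}) : K :=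
  \prod_i z i ^+ a i.

Definition wdeg {n} (w : 'I_n -> nat) (a : 'X_{1..n}) : nat := (\sum_i w i * a i)%N.

Lemma mon_neq0 {K : fieldType} {n} (z : 'I_n -> K) (a : 'X_{1..n}) :
  (forall i, a i != 0%N -> z i != 0) -> mon z a != 0.
Proof.
move=> h; apply/prodf_neq0 => i _; case: (eqVneq (a i) 0%N) => [->|/h zi].
  by rewrite expr0 oner_neq0.
exact: expf_neq0.
Qed.

Lemma mon_eq0 {K : comNzRingType} {n} (z : 'I_n -> K) (a : 'X_{1..n}) i :
  z i = 0 -> a i != 0%N -> mon z a = 0.
Proof. by move=> zi ai; rewrite /mon (bigD1 i) //= zi expr0n (negbTE ai) mul0r. Qed.

Lemma eq_mon {K : comNzRingType} {n} (z z' : 'I_n -> K) (a : 'X_{1..n}) :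
  (forall i, a i != 0%N -> z i = z' i) -> mon z a = mon z' a.
Proof.
move=> h; apply: eq_bigr => i _; case: (eqVneq (a i) 0%N) => [->|/h -> //].
by rewrite !expr0.
Qed.

Lemma common_den {n} (v : 'I_n -> rat) : (forall i, 0 <= v i) ->
  exists (N : nat) (w : 'I_n -> nat), (0 < N)%N /\ forall i, (w i)%:R = N%:R * v i.
Proof.
move=> v0; exists (\prod_i `|denq (v i)|)%N.
exists (fun i => `|numq (v i)| * \prod_(j | j != i) `|denq (v j)|)%N; split.
  by apply: prodn_gt0 => i; rewrite absz_gt0 denq_neq0.
move=> i; rewrite [in RHS](bigD1 i) //= !natrM.
have -> : (`|numq (v i)|%N%:R : rat) = `|denq (v i)|%N%:R * v i.
  rewrite mulrC.
  rewrite !natr_absz !ger0_norm ?numq_ge0 ?denq_ge0 //.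
  by rewrite numqE.
by rewrite mulrAC.
Qed.

Section ToricLimit.
Context {R : realType} {U : (nat -> Prop) -> Prop} (uU : ultra U) {n : nat}.

Lemma ulim_mon (z : nat -> 'I_n -> R[i]) (q : 'I_n -> R[i]) a :
  (forall i, ulim U (fun m => z m i) (q i)) -> ulim U (fun m => mon (z m) a) (mon q a).
Proof.
by move=> zq; apply: (ulim_prod uU) => i _; apply: (ulim_exp uU).
Qed.

(** [J] is the set of coordinates that are nonzero along the sequence and [D] a finite list of
    exponents to be compared. An exponent [b] supported in [J] has a nonzero monomial, so dividing
    by it is meaningful. Equal weights give the ratio at [zt]; a larger weight in the numerator
    gives 0. *)
Lemma toric_limit (z : nat -> 'I_n -> R[i]) (q : 'I_n -> R[i]) (J : {set 'I_n})
    (D : seq 'X_{1..n}) :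
  (forall i, ulim U (fun m => z m i) (q i)) ->
  U (fun m => forall i, (z m i == 0) = (i \notin J)) ->
  exists (w : 'I_n -> nat) (zt : 'I_n -> R[i]),
    [/\ in_torus zt, forall i, (w i == 0%N) = (q i != 0),
        forall i, q i != 0 -> zt i = q i,
        forall a b, a \in D -> b \in D -> (forall i, i \notin J -> b i = 0%N) ->
          (exists2 i, i \notin J & a i != 0%N) -> (wdeg w b < wdeg w a)%N
      & forall a b, a \in D -> b \in D -> (forall i, i \notin J -> b i = 0%N) ->
          (wdeg w a = wdeg w b ->
             ulim U (fun m => mon (z m) a / mon (z m) b) (mon zt a / mon zt b)) /\
          ((wdeg w b < wdeg w a)%N ->
             ulim U (fun m => mon (z m) a / mon (z m) b) 0)].
Proof.
move=> zq zJ.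
(* Vanishing coordinates have no logarithm; replacing them by 1 makes their logarithm 0. They are
   handled separately by a large weight. *)
pose z1 m i := if z m i == 0 then 1 else z m i.
pose u m i := exp.ln (cn2 (z1 m i)).
have z10 m i : z1 m i != 0 by rewrite /z1; case: ifP => [_|->//]; exact: oner_neq0.
have uE m i : sequences.expR (u m i) = cn2 (z1 m i).
  by rewrite exp.lnK // posrE cn2_gt0.
have z1z i : i \in J -> U (fun m => z1 m i = z m i).
  by move=> iJ; apply: (ultraS _ uU _ _ zJ) => m /(_ i); rewrite iJ /z1 => ->.
pose e (a b : 'X_{1..n}) : 'rV[rat]_n := \row_i ((a i)%:R - (b i)%:R).
pose dl (i : 'I_n) : 'rV[rat]_n := delta_mx 0 i.
(* Including the unit vectors [dl i] lets the sign of each single weight be read from the behaviour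
   of that coordinate. *)
have [wr [y [uy hs]]] := rational_weight uU u
  ([seq e a b | a <- D, b <- D] ++ [seq dl i | i <- enum 'I_n]).
have dlw i : (dl i *m wr) 0 0 = wr i 0 by rewrite -rowE mxE.
have dlu (v : 'I_n -> R) i : ratpair v (dl i) = v i.
  rewrite /ratpair (bigD1 i) //= big1 ?addr0 => [|j ji].
    by rewrite mxE !eqxx rmorph1 mul1r.
  by rewrite mxE eqxx (negbTE ji) rmorph0 mul0r.
have hdl i : [\/ wr i 0 = 0 /\ (forall m, y m i = 0),
    0 < wr i 0 /\ (forall M, U (fun m => u m i < M))
  | wr i 0 < 0 /\ (forall M, U (fun m => M < u m i))].
  case: (hs (dl i)); first by rewrite mem_cat map_f ?mem_enum ?orbT.
  - by rewrite dlw => -[h1 h2]; apply: Or31; split=> // m; rewrite -(dlu (y m)).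
  - rewrite dlw => -[h1 h2]; apply: Or32; split=> // M.
    by apply: (ultraS _ uU _ _ (h2 M)) => m; rewrite dlu.
  - rewrite dlw => -[h1 h2]; apply: Or33; split=> // M.
    by apply: (ultraS _ uU _ _ (h2 (- M))) => m; rewrite ratpairN dlu ltrN2.
have qJ i : i \notin J -> q i = 0.
  move=> iJ; apply: (ulim_uniq uU _ _ _ (zq i)).
  apply: (ulim_near uU _ _ _ _ (ulim_cst uU 0)).
  by apply: (ultraS _ uU _ _ zJ) => m /(_ i); rewrite iJ => /eqP.
have contra (A B : nat -> Prop) : U A -> U B -> (forall m, A m -> ~ B m) -> False.
  by move=> UA UB h; have [m [/h]] := ultra_ex uU _ (ultraI _ uU _ _ UA UB).
have wJ0 i : i \notin J -> wr i 0 = 0.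
  move=> iJ; have u0 : U (fun m => u m i = 0).
    apply: (ultraS _ uU _ _ zJ) => m /(_ i).
    by rewrite iJ /u /z1 => ->; rewrite cn21 exp.ln1.
  case: (hdl i) => -[] // _ h; exfalso; apply: (contra _ _ u0 (h 0)) => m ->;
    by rewrite ltxx.
have ub i : exists M, U (fun m => u m i <= M).
  have [M M0 zM] := ulim_bounded uU _ _ (zq i).
  exists (exp.ln (Num.max 1 M)); apply: (ultraS _ uU _ _ zM) => m h.
  have m0 : 0 < Num.max 1 M by rewrite lt_max ltr01.
  rewrite -exp.ler_expR uE exp.lnK // /z1; case: ifP => _.
    by rewrite cn21 le_max lexx.
  by rewrite le_max h orbT.
have wq i : i \in J -> q i = 0 -> 0 < wr i 0.
  move=> iJ qi; have zi : forall M, U (fun m => u m i < M).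
    move=> M; have := zq i; rewrite qi => /(_ _ (exp.expR_gt0 M)).
    move=> h; apply: (ultraS2 uU _ _ _ h (z1z i iJ)) => m h1 h2.
    by rewrite -exp.ltr_expR uE h2 -[z m i]subr0.
  case: (hdl i) => -[] // _ h; exfalso.
    have [M uM] := uy i.
    apply: (contra _ _ uM (zi (- M))) => m; rewrite h subr0 ler_norml => /andP[h1 _].
    by apply/negP; rewrite -leNgt.
  apply: (contra _ _ (zi 0) (h 0)) => m h1.
  by apply/negP; rewrite -leNgt ltW.
have wq0 i : q i != 0 -> wr i 0 = 0 /\ (forall m, y m i = 0).
  move=> qi; have iJ : i \in J by apply: contraTT qi => /qJ ->; rewrite eqxx.
  have c0 : 0 < cn2 (q i) / 4 by rewrite divr_gt0 ?cn2_gt0 //; lra.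
  case: (hdl i) => // -[] _ h; exfalso.
    apply: (contra _ _ (ulim_gt uU _ _ qi (zq i))
      (ultraI _ uU _ _ (h (exp.ln (cn2 (q i) / 4))) (z1z i iJ))) => m h1 [h2 h3].
    move: h2; rewrite -exp.ltr_expR uE exp.lnK // h3 => h2.
    by have := lt_trans h1 h2; rewrite ltxx.
  have [M uM] := ub i; apply: (contra _ _ uM (h M)) => m h1.
  by apply/negP; rewrite -leNgt.
have wr0 i : 0 <= wr i 0.
  case: (boolP (i \in J)) => [iJ|/wJ0-> //].
  by case: (eqVneq (q i) 0) => [/(wq _ iJ)/ltW//|/wq0[->]].
have [N [wn [N0 wnE]]] := common_den (fun i => wr i 0) wr0.
have NQ : 0 < N%:R :> rat by rewrite ltr0n.
have wn0 i : (wn i == 0%N) = (wr i 0 == 0).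
  by rewrite -(eqr_nat rat) wnE mulf_eq0 (gt_eqF NQ).
(* [W] exceeds the weight of every exponent of [D] supported in [J], so any exponent involving a
   vanishing coordinate is strictly heavier. *)
pose W := (1 + \sum_(b <- D) wdeg wn b)%N.
pose w i := if i \in J then wn i else W.
have wdegJ (b : 'X_{1..n}) : (forall i, i \notin J -> b i = 0%N) -> wdeg w b = wdeg wn b.
  move=> bJ; apply: eq_bigr => i _; rewrite /w; case: ifPn => // /bJ ->.
  by rewrite !muln0.
have bigW (a b : 'X_{1..n}) : a \in D -> b \in D -> (forall i, i \notin J -> b i = 0%N) ->
    (exists2 i, i \notin J & a i != 0%N) -> (wdeg w b < wdeg w a)%N.
  move=> aD bD bJ [i iJ ai]; rewrite wdegJ //; apply: (@leq_trans W).
    by rewrite /W add1n ltnS (big_rem b) //= leq_addr.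
  rewrite /wdeg (bigD1 i) //= /w (negbTE iJ).
  by apply: leq_trans (leq_addr _ _); rewrite leq_pmulr // lt0n.
have eD a b : a \in D -> b \in D ->
    e a b \in [seq e a b | a <- D, b <- D] ++ [seq dl i | i <- enum 'I_n].
  by move=> aD bD; rewrite mem_cat allpairs_f.
have ew a b : N%:R * (e a b *m wr) 0 0 = (wdeg wn a)%:R - (wdeg wn b)%:R.
  rewrite !natr_sum -sumrB mxE mulr_sumr; apply: eq_bigr => i _.
  by rewrite !natrM wnE mxE; ring.
have mz1 (a : 'X_{1..n}) : (forall i, i \notin J -> a i = 0%N) ->
    U (fun m => mon (z m) a = mon (z1 m) a).
  move=> aJ; apply: (ultraS _ uU _ _ zJ) => m h; apply: eq_mon => i ai.
  have iJ : i \in J by apply: contraNT ai => /aJ ->.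
  by rewrite /z1 h iJ.
(* The half appears because [u] is the logarithm of the squared modulus. After the correction the
   squared modulus is [exp (u - y)], bounded above and away from 0, so the limit exists in the
   torus. *)
pose f m i : R[i] := (sequences.expR (- y m i / 2))%:C%C.
pose ztm m i := z1 m i * f m i.
have cztm m i : cn2 (ztm m i) = sequences.expR (u m i - y m i).
  rewrite cn2M cn2_real exp.expRD uE expr2 -exp.expRD; congr (_ * sequences.expR _).
  by field.
have /choice[zt ztP] : forall i, exists l, ulim U (fun m => ztm m i) l /\ l != 0.
  move=> i; have [M uM] := uy i.
  have [|l hl] := ulim_exists uU (fun m => ztm m i) (sequences.expR M).
    apply: (ultraS _ uU _ _ uM) => m; rewrite cztm exp.ler_expR.
    by rewrite ler_norml => /andP[].
  exists l; split=> //; apply/eqP => l0; rewrite l0 in hl.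
  apply: (contra _ _ uM (hl _ (exp.expR_gt0 (- M)))) => m.
  rewrite subr0 cztm exp.ltr_expR ler_norml => /andP[h _].
  by apply/negP; rewrite -leNgt.
exists w, zt; split => //.
- by move=> i; apply/eqP; case: (ztP i).
- move=> i; rewrite /w; case: ifPn => [iJ|/qJ->]; last by rewrite eqxx.
  rewrite wn0; case: (eqVneq (q i) 0) => [/(wq _ iJ)/gt_eqF->//|/wq0[-> _]].
  by rewrite eqxx.
- move=> i qi; have iJ : i \in J by apply: contraTT qi => /qJ ->; rewrite eqxx.
  apply: (ulim_uniq uU (fun m => ztm m i)); first by case: (ztP i).
  apply: (ulim_near uU _ _ _ _ (zq i)).
  apply: (ultraS _ uU _ _ (z1z i iJ)) => m h.
  by rewrite /ztm h /f (wq0 i qi).2 oppr0 mul0r exp.expR0 mulr1.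
move=> a b aD bD bJ.
have [aJ|] := pselect (forall i, i \notin J -> a i = 0%N); last first.
  move=> /existsNP[i /not_implyP[iJ /eqP ai]]; split.
    move=> wab; have := bigW a b aD bD bJ (ex_intro2 _ _ i iJ ai).
    by rewrite wab ltnn.
  move=> _; apply: (ulim_near uU _ _ _ _ (ulim_cst uU 0)).
  apply: (ultraS _ uU _ _ zJ) => m /(_ i); rewrite iJ => /eqP zi.
  by rewrite (mon_eq0 (z m) a i zi ai) mul0r.
rewrite !wdegJ //; split => [wab|wab].
  have g0 : (e a b *m wr) 0 0 = 0.
    apply: (mulfI (x := N%:R)); first by rewrite (gt_eqF NQ).
    by rewrite ew wab subrr mulr0.
  have yab m : ratpair (y m) (e a b) = 0.
    by case: (hs _ (eD a b aD bD)) => -[]; rewrite g0 ?ltxx.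
  have mf m c : mon (f m) c = (sequences.expR (- (\sum_i (c i)%:R * y m i) / 2))%:C%C.
    rewrite mulNr -mulrN mulr_suml exp.expR_sum rmorph_prod; apply: eq_bigr => i _.
    rewrite /f -rmorphXn -exp.expRM_natl; congr (sequences.expR _)%:C%C; ring.
  (* For equal weights [y] pairs to zero with [a - b], so the correction factors cancel in the ratio
     of the two monomials. *)
  have mfab m : mon (f m) a = mon (f m) b.
    rewrite !mf; congr (sequences.expR (- _ / 2))%:C%C; apply/eqP; rewrite -subr_eq0.
    rewrite -sumrB; apply/eqP; rewrite -[RHS](yab m).
    by apply: eq_bigr => i _; rewrite mxE rmorphB !rmorph_nat mulrBl.
  have f0 m c : mon (f m) c != 0.
    apply: mon_neq0 => i _; rewrite -cn2_eq0 cn2_real.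
    by rewrite expf_neq0 // gt_eqF // exp.expR_gt0.
  have lim c : ulim U (fun m => mon (ztm m) c) (mon zt c).
    by apply: ulim_mon => i; case: (ztP i).
  have zt0 : mon zt b != 0 by apply: mon_neq0 => i _; case: (ztP i).
  apply: (ulim_near uU _ _ _ _ (ulim_div uU _ _ _ _ zt0 (lim a) (lim b))).
  apply: (ultraS2 uU _ _ _ (mz1 a aJ) (mz1 b bJ)) => m -> ->.
  have monM c : mon (ztm m) c = mon (z1 m) c * mon (f m) c.
    by rewrite /mon -big_split; apply: eq_bigr => i _; rewrite exprMn.
  by rewrite !monM mfab -mulf_div divff ?mulr1.
have g0 : 0 < (e a b *m wr) 0 0.
  by rewrite -(pmulr_rgt0 _ NQ) ew subr_gt0 ltr_nat.
have uab M : U (fun m => ratpair (u m) (e a b) < M).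
  case: (hs _ (eD a b aD bD)) => -[]; first by move=> h; rewrite h ltxx in g0.
    by move=> _ /(_ M).
  by move=> h; have := lt_trans h g0; rewrite ltxx.
move=> eps eps0; have := uab (exp.ln eps) => h.
apply: (ultraS2 uU _ _ _ h (ultraI _ uU _ _ (mz1 a aJ) (mz1 b bJ))) => m h1 [-> ->].
have cm c : cn2 (mon (z1 m) c) = sequences.expR (\sum_i (c i)%:R * u m i).
  rewrite cn2_prod exp.expR_sum; apply: eq_bigr => i _.
  by rewrite cn2X exp.expRM_natl uE.
rewrite subr0 cn2M cn2V !cm -exp.expRN -exp.expRD -(exp.lnK (x := eps)) ?posrE //.
rewrite exp.ltr_expR -sumrB; apply: le_lt_trans h1; rewrite le_eqVlt; apply/orP; left.
by apply/eqP; apply: eq_bigr => i _; rewrite mxE rmorphB !rmorph_nat mulrBl.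
Qed.
End ToricLimit.

(** * Values and gradients *)

Section Polynomials.
Context {R : realType} {n : nat}.
Implicit Types (F G : {mpoly {poly R[i]}[n]}) (x p v : pt R n) (t : R[i]).

Lemma fiberpE F t : fiberp F t = map_mpoly (horner_eval t) F.
Proof. by []. Qed.

Lemma mcoeff_fiberp F t a : (fiberp F t)@_a = (F@_a).[t].
Proof. by rewrite fiberpE mcoeff_map_mpoly. Qed.

Lemma msupp_fiberp F t a : a \in msupp (fiberp F t) -> a \in msupp F.
Proof.
by rewrite !mcoeff_msupp mcoeff_fiberp; apply: contraNneq => ->; rewrite horner0.
Qed.

Lemma evalF_prod (I : Type) (r : seq I) (P : pred I) (f : I -> {mpoly {poly R[i]}[n]}) x :
  evalF (\prod_(i <- r | P i) f i) x = \prod_(i <- r | P i) evalF (f i) x.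
Proof. by rewrite /evalF fiberpE !rmorph_prod. Qed.

Lemma evalFE F x : evalF F x = \sum_(a <- msupp F) (F@_a).[x.1] * mon x.2 a.
Proof.
rewrite /evalF fiberpE /map_mpoly /mmap raddf_sum; apply: eq_bigr => a _.
by rewrite /= mevalM mevalC mmap1_id mevalX.
Qed.

Lemma gradF_tE F x :
  (gradF F x).1 = \sum_(a <- msupp F) ((F@_a)^`()).[x.1] * mon x.2 a.
Proof.
rewrite /gradF /=; set G := map_mpoly _ F.
have -> : G = \sum_(a <- msupp F) (F@_a)^`() *: 'X_[a].
  by rewrite /G /map_mpoly /mmap; apply: eq_bigr => a _; rewrite /= mmap1_id mul_mpolyC.
rewrite /evalF fiberpE (raddf_sum (map_mpoly _)) /= raddf_sum; apply: eq_bigr => a _.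
by rewrite /= map_mpolyZ map_mpolyX mevalZ mevalX.
Qed.

Lemma mderiv_fiberp F t i : fiberp (mderiv i F) t = mderiv i (fiberp F t).
Proof.
apply/mpolyP => a; rewrite mcoeff_fiberp !mcoeff_mderiv mcoeff_fiberp.
by rewrite hornerMn.
Qed.

(** The factor [z i] restores the exponent lowered by differentiation, so the formula has no
    truncated subtraction and also holds when [z i] or [a i] is 0. *)
Lemma mderiv_monE (c : 'X_{1..n} -> R[i]) (z : 'I_n -> R[i]) (s : seq 'X_{1..n}) i :
  z i * (mderiv i (\sum_(a <- s) c a *: 'X_[a])).@[z] =
    \sum_(a <- s) (a i)%:R * (c a * mon z a).
Proof.
rewrite (raddf_sum (mderiv i)) /= raddf_sum mulr_sumr; apply: eq_bigr => a _ /=.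
rewrite mderivZ mevalZ mderivX mevalZ mevalX /mon.
rewrite (bigD1 i) //= [in RHS](bigD1 i) //= mnmBE mnm1E eqxx.
have -> : \prod_(j < n | j != i) z j ^+ (a - U_(i))%MM j =
          \prod_(j < n | j != i) z j ^+ a j.
  by apply: eq_bigr => j ji; rewrite mnmBE mnm1E eq_sym (negbTE ji) subn0.
case: (a i) => [|k]; first by rewrite !mul0r !mulr0.
by rewrite subn1 /= exprS; ring.
Qed.

Lemma gradF_zE F x i :
  x.2 i * (gradF F x).2 i = \sum_(a <- msupp F) (a i)%:R * ((F@_a).[x.1] * mon x.2 a).
Proof.
rewrite /gradF /= /evalF mderiv_fiberp -mderiv_monE; congr (_ * (mderiv i _).@[_]).
by apply: eq_bigr => a _; rewrite /= mmap1_id mul_mpolyC.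
Qed.

(** Freezing [z] leaves a polynomial in [t], whose formal derivative computes the [t]-component of
    the gradient; the product rule is inherited from [{poly R[i]}]. *)
Definition zpoly F (z : 'I_n -> R[i]) : {poly R[i]} := F.@[fun i => (z i)%:P].

Lemma zpolyE F z : zpoly F z = \sum_(a <- msupp F) F@_a * (mon z a)%:P.
Proof.
rewrite /zpoly mevalE; apply: eq_bigr => a _; congr (_ * _).
by rewrite /mon rmorph_prod; apply: eq_bigr => i _; rewrite rmorphXn.
Qed.

Lemma evalF_zpoly F x : evalF F x = (zpoly F x.2).[x.1].
Proof.
by rewrite evalFE zpolyE horner_sum; apply: eq_bigr => a _; rewrite hornerM hornerC.
Qed.

Lemma gradF_zpoly F x : (gradF F x).1 = ((zpoly F x.2)^`()).[x.1].
Proof.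
rewrite gradF_tE zpolyE (raddf_sum (@deriv _)) horner_sum; apply: eq_bigr => a _ /=.
by rewrite derivM derivC mulr0 addr0 hornerM hornerC.
Qed.

Lemma evalFM F G x : evalF (F * G) x = evalF F x * evalF G x.
Proof. by rewrite /evalF fiberpE rmorphM mevalM. Qed.

Lemma evalFD F G x : evalF (F + G) x = evalF F x + evalF G x.
Proof. by rewrite /evalF fiberpE rmorphD mevalD. Qed.

Lemma gradFM_t F G x :
  (gradF (F * G) x).1 = (gradF F x).1 * evalF G x + evalF F x * (gradF G x).1.
Proof.
apply: (etrans (gradF_zpoly (F * G) x)).
rewrite /zpoly mevalM derivM hornerD !hornerM; congr (_ * _ + _ * _); apply/esym;
  [exact: gradF_zpoly | exact: evalF_zpoly | exact: evalF_zpoly | exact: gradF_zpoly].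
Qed.

Lemma gradFD_t F G x : (gradF (F + G) x).1 = (gradF F x).1 + (gradF G x).1.
Proof.
apply: (etrans (gradF_zpoly (F + G) x)).
by rewrite /zpoly mevalD derivD hornerD; congr (_ + _); apply/esym; exact: gradF_zpoly.
Qed.

Lemma gradFM_z F G x i :
  (gradF (F * G) x).2 i = (gradF F x).2 i * evalF G x + evalF F x * (gradF G x).2 i.
Proof. by rewrite /gradF /= mderivM evalFD !evalFM. Qed.

Lemma gradFD_z F G x i : (gradF (F + G) x).2 i = (gradF F x).2 i + (gradF G x).2 i.
Proof. by rewrite /gradF /= mderivD evalFD. Qed.

Lemma gradF_prod {k0 : nat} (f : 'I_k0 -> {mpoly {poly R[i]}[n]}) (x : pt R n) :
  (gradF (\prod_k f k) x).1 =
    \sum_k (\prod_(j | j != k) evalF (f j) x) * (gradF (f k) x).1 /\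
  forall i, (gradF (\prod_k f k) x).2 i =
    \sum_k (\prod_(j | j != k) evalF (f j) x) * (gradF (f k) x).2 i.
Proof.
(* One Leibniz argument serves all partial derivatives: [d] is any map killing 1 and satisfying the
   product rule at [x]. *)
have gen (d : {mpoly {poly R[i]}[n]} -> R[i]) : d 1 = 0 ->
    (forall F G, d (F * G) = d F * evalF G x + evalF F x * d G) ->
    forall s : seq 'I_k0, uniq s ->
    d (\prod_(k <- s) f k) = \sum_(k <- s) (\prod_(j <- s | j != k) evalF (f j) x) * d (f k).
  move=> d1 dM; elim=> [|k s IH] /=; first by rewrite !big_nil.
  move=> /andP[ks us]; rewrite !big_cons eqxx dM IH // mulrC evalF_prod; congr (_ * _ + _).
    rewrite [in RHS]big_seq_cond [in LHS]big_seq; apply: eq_bigl => j.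
    by case: (boolP (j \in s)) => //= js; apply/esym; apply: contraNneq ks => <-.
  rewrite mulr_sumr big_seq [in RHS]big_seq; apply: eq_bigr => j js.
  rewrite big_cons ifT ?mulrA //; by apply: contraNneq ks => ->.
have g1 : evalF 1 x = 1 by rewrite /evalF fiberpE rmorph1 meval1.
split=> [|i].
  apply: (gen (fun F => (gradF F x).1) _ _ _ (index_enum_uniq _)) => [|F G].
    apply: (etrans (gradF_zpoly 1 x)).
    by rewrite /zpoly meval1 -polyC1 derivC horner0.
  exact: gradFM_t.
apply: (gen (fun F => (gradF F x).2 i) _ _ _ (index_enum_uniq _)) => [|F G].
  by rewrite /gradF /= -mpolyC1 mderivC /evalF fiberpE rmorph0 meval0.
exact: gradFM_z.
Qed.

Lemma pt_pair_gradFM F G p v :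
  pt_pair (gradF (F * G) p) v =
    pt_pair (gradF F p) v * evalF G p + evalF F p * pt_pair (gradF G p) v.
Proof.
transitivity (((gradF F p).1 * evalF G p + evalF F p * (gradF G p).1) * v.1 +
  \sum_i ((gradF F p).2 i * evalF G p + evalF F p * (gradF G p).2 i) * v.2 i).
  rewrite /pt_pair; congr (_ * _ + _); first exact: gradFM_t.
  by apply: eq_bigr => i _; congr (_ * _); exact: gradFM_z.
rewrite /pt_pair; move: (gradF F p) (gradF G p) (evalF F p) (evalF G p) => a b c d.
rewrite !mulrDl !mulrDr mulr_suml mulr_sumr.
rewrite (eq_bigr (fun i => a.2 i * v.2 i * d + c * (b.2 i * v.2 i))) => [|i _]; last by ring.
by rewrite big_split /=; ring.
Qed.

Lemma pt_pair_gradFD F G p v :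
  pt_pair (gradF (F + G) p) v = pt_pair (gradF F p) v + pt_pair (gradF G p) v.
Proof.
transitivity (((gradF F p).1 + (gradF G p).1) * v.1 +
  \sum_i ((gradF F p).2 i + (gradF G p).2 i) * v.2 i).
  rewrite /pt_pair; congr (_ * _ + _); first exact: gradFD_t.
  by apply: eq_bigr => i _; congr (_ * _); exact: gradFD_z.
rewrite /pt_pair; move: (gradF F p) (gradF G p) => a b.
rewrite (eq_bigr (fun i => a.2 i * v.2 i + b.2 i * v.2 i)) => [|i _]; last by ring.
by rewrite big_split /=; ring.
Qed.

Lemma pt_pair_gradFC (q : {poly R[i]}) p v :
  pt_pair (gradF q%:MP p) v = (q^`()).[p.1] * v.1.
Proof.
rewrite /pt_pair big1 => [|i _]; last first.
  by rewrite /gradF /= mderivC /evalF fiberpE rmorph0 meval0 mul0r.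
rewrite addr0; congr (_ * _); apply: (etrans (gradF_zpoly _ _)).
by rewrite /zpoly mevalC.
Qed.

Lemma evalFC (q : {poly R[i]}) p : evalF q%:MP p = q.[p.1].
Proof. by rewrite evalF_zpoly /zpoly mevalC. Qed.

Lemma evalFX i p : evalF 'X_i p = p.2 i.
Proof. by rewrite evalF_zpoly /zpoly mevalXU hornerC. Qed.

Lemma pt_pair_gradFX i p v : pt_pair (gradF 'X_i p) v = v.2 i.
Proof.
rewrite /pt_pair.
have -> : (gradF 'X_i p).1 = 0.
  by apply: (etrans (gradF_zpoly _ _)); rewrite /zpoly mevalXU derivC horner0.
have e j : (gradF 'X_i p).2 j = (i == j)%:R.
  rewrite /gradF /= mderivX mnm1E; case: eqVneq => [<-|ij].
    have -> : (U_(i) - U_(i))%MM = 0%MM :> 'X_{1..n}.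
      by apply/mnmP => l; rewrite mnmBE subnn mnm0E.
    by rewrite scale1r mpolyX0 -mpolyC1 evalFC hornerC.
  by rewrite scale0r -mpolyC0 evalFC horner0.
rewrite mul0r add0r (eq_bigr (fun j => (i == j)%:R * v.2 j)) => [|j _]; last first.
  by congr (_ * _); apply: e.
rewrite (bigD1 i) //= big1 ?addr0 => [|j ji]; first by rewrite eqxx mul1r.
by rewrite eq_sym (negbTE ji) mul0r.
Qed.

(** * Limits of values, gradients and secants *)

Section Limits.
Context {U : (nat -> Prop) -> Prop} (uU : ultra U).
Variables (x : nat -> pt R n) (p : pt R n).
Hypothesis xt : ulim U (fun m => (x m).1) p.1.
Hypothesis xz : forall i, ulim U (fun m => (x m).2 i) (p.2 i).

Lemma ulim_evalF F : ulim U (fun m => evalF F (x m)) (evalF F p).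
Proof.
rewrite evalFE; apply: (ulim_ext uU (fun m =>
  \sum_(a <- msupp F) (F@_a).[(x m).1] * mon (x m).2 a)).
  by move=> m; rewrite evalFE.
apply: (ulim_sum uU) => a _; apply: (ulim_mul uU); first exact: ulim_horner.
exact: ulim_mon.
Qed.

Lemma ulim_gradF_t F : ulim U (fun m => (gradF F (x m)).1) (gradF F p).1.
Proof. exact: ulim_evalF. Qed.

Lemma ulim_gradF_z F i : ulim U (fun m => (gradF F (x m)).2 i) ((gradF F p).2 i).
Proof. exact: ulim_evalF. Qed.

(** Differentiability without Taylor expansion: the property holds for constants and coordinates and
    is stable under sums and products, hence holds for every polynomial. *)
Lemma ulim_secant F (c : nat -> R[i]) v :
  ulim U (fun m => c m * ((x m).1 - p.1)) v.1 ->
  (forall i, ulim U (fun m => c m * ((x m).2 i - p.2 i)) (v.2 i)) ->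
  ulim U (fun m => c m * (evalF F (x m) - evalF F p)) (pt_pair (gradF F p) v).
Proof.
move=> ct cz.
pose L F := ulim U (fun m => c m * (evalF F (x m) - evalF F p)) (pt_pair (gradF F p) v).
have LM G H : L G -> L H -> L (G * H).
  move=> LG LH; rewrite /L pt_pair_gradFM.
  apply: (ulim_ext uU _ _ _ _ (ulim_add uU _ _ _ _ (ulim_mul uU _ _ _ _ LG (ulim_evalF H))
    (ulim_mulc uU _ _ (evalF G p) LH))) => m.
  rewrite (evalFM G H (x m)) (evalFM G H p); move: (evalF G) (evalF H) => a b; ring.
have LD G H : L G -> L H -> L (G + H).
  move=> LG LH; rewrite /L pt_pair_gradFD.
  apply: (ulim_ext uU _ _ _ _ (ulim_add uU _ _ _ _ LG LH)) => m.
  rewrite (evalFD G H (x m)) (evalFD G H p); move: (evalF G) (evalF H) => a b; ring.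
have Lcst (e : R[i]) : L (e%:P)%:MP.
  rewrite /L pt_pair_gradFC derivC horner0 mul0r.
  by apply: (ulim_ext uU _ _ _ _ (ulim_cst uU 0)) => m; rewrite !evalFC !hornerC subrr mulr0.
have LX : L ('X)%:MP.
  rewrite /L pt_pair_gradFC derivX hornerC mul1r.
  by apply: (ulim_ext uU _ _ _ _ ct) => m; rewrite !evalFC !hornerX.
have LXi i : L 'X_i.
  rewrite /L pt_pair_gradFX.
  by apply: (ulim_ext uU _ _ _ _ (cz i)) => m; rewrite !evalFX.
have L1 : L 1 by rewrite -mpolyC1; apply: Lcst.
have LXn i k : L ('X_i ^+ k).
  by elim: k => [|k IH]; [rewrite expr0|rewrite exprS; apply: LM; [exact: LXi|exact: IH]].
have LC (q : {poly R[i]}) : L q%:MP.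
  elim/poly_ind: q => [|q e Lq]; first by rewrite -polyC0; apply: Lcst.
  by rewrite mpolyCD mpolyCM; apply: LD; [apply: LM; [exact: Lq|exact: LX]|exact: Lcst].
suff : L (\sum_(a <- msupp F) F@_a *: 'X_[a]) by rewrite -mpolyE.
apply: (big_ind L); [by rewrite -mpolyC0; apply: LC | exact: LD |].
move=> a _; rewrite -mul_mpolyC; apply: (LM); first exact: LC.
by rewrite mpolyXE_id; apply: (big_ind L); [exact: L1|exact: LM|move=> i _; exact: LXn].
Qed.
End Limits.
End Polynomials.

(** * Newton boundaries and face functions *)

Section Newton.
Context {R : realType} {n : nat}.
Implicit Types (g : {mpoly R[i][n]}) (w : 'I_n -> nat) (a b : 'X_{1..n}).

Lemma seq_argmin (T : eqType) (s : seq T) (d : T -> nat) (x0 : T) : x0 \in s ->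
  exists2 x, x \in s & forall y, y \in s -> (d x <= d y)%N.
Proof.
elim: s x0 => // x s IH x0 _; case: s IH => [_|y s IH].
  by exists x; rewrite ?mem_seq1 // => y; rewrite mem_seq1 => /eqP ->.
have [z zs zm] := IH y (mem_head _ _).
case: (leqP (d x) (d z)) => h.
  exists x; first exact: mem_head.
  by move=> t; rewrite in_cons => /orP[/eqP->//|/zm]; exact: leq_trans.
exists z; first by rewrite in_cons zs orbT.
by move=> t; rewrite in_cons => /orP[/eqP->|/zm//]; exact: ltnW.
Qed.

Lemma wdot_mnm w a : wdot (nat_weight w) (mnm_real a) = (wdeg w a)%:R :> R.
Proof. by rewrite /wdeg natr_sum; apply: eq_bigr => i _; rewrite natrM. Qed.

Lemma Gamma_plus_supp g a : a \in msupp g -> Gamma_plus g (mnm_real a).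
Proof.
move=> ag; exists 1%N, (fun=> a), (fun _ _ => 0), (fun=> 1); split=> //.
do 2![split=> //]; split; first by rewrite big_ord1.
by move=> i; rewrite big_ord1 addr0 mul1r.
Qed.

Lemma Gamma_plus_ge0 g x i : Gamma_plus g x -> 0 <= x i.
Proof.
move=> [N [b [r [l [_ [r0 [l0 [_ ->]]]]]]]]; apply: sumr_ge0 => j _.
by rewrite mulr_ge0 // addr_ge0 // ler0n.
Qed.

Lemma Gamma_plus_wdot g x w d : Gamma_plus g x ->
  (forall b, b \in msupp g -> (d <= wdeg w b)%N) -> d%:R <= wdot (nat_weight w) x.
Proof.
move=> [N [b [r [l [bg [r0 [l0 [l1 xE]]]]]]]] dmin.
rewrite -[d%:R]mul1r -[X in X * _ <= _]l1 mulr_suml /wdot.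
rewrite (eq_bigr (fun i => \sum_(j < N) l j * (nat_weight w i * ((b j i)%:R + r j i)))); last first.
  by move=> i _; rewrite xE mulr_sumr; apply: eq_bigr => j _; ring.
rewrite exchange_big; apply: ler_sum => j _; rewrite -mulr_sumr ler_wpM2l //.
apply: (@le_trans _ _ (wdeg w (b j))%:R); first by rewrite ler_nat dmin.
rewrite -wdot_mnm; apply: ler_sum => i _.
by rewrite ler_wpM2l ?ler0n // lerDl.
Qed.

(** As the weights are nonnegative, their minimum over the polyhedron is already the minimum [d]
    over the support, so lying on the face is an equality of degrees. *)
Lemma DeltaP g w a d : a \in msupp g -> (forall b, b \in msupp g -> (d <= wdeg w b)%N) ->
  (exists2 b, b \in msupp g & wdeg w b = d) ->
  Delta (nat_weight w) g (mnm_real a) <-> wdeg w a = d.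
Proof.
move=> ag dmin [b bg bd]; split=> [[_ h]|ad].
  apply/eqP; rewrite eqn_leq dmin // andbT -bd -(ler_nat R) -!wdot_mnm.
  exact: h (Gamma_plus_supp _ _ bg).
split=> [|y gy]; first exact: Gamma_plus_supp.
by rewrite wdot_mnm ad; apply: Gamma_plus_wdot gy dmin.
Qed.

Lemma newton_boundary_vertex g w a : a \in msupp g -> (forall i, 0 < w i)%N ->
  (forall b, b \in msupp g -> (wdeg w a <= wdeg w b)%N) ->
  newton_boundary g (mnm_real a).
Proof.
move=> ag w0 amin.
have Da : Delta (nat_weight w) g (mnm_real a) by apply/DeltaP; eauto.
exists (nat_weight w); split; first by move=> i; apply: ler0n.
(* Compactness of the face: positive integer weights are at least 1 and coordinates are nonnegative,
   so each coordinate is at most the minimal value of [w]. *)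
split=> //; exists (wdeg w a)%:R => y [gy ymin] i.
rewrite ger0_norm; last exact: Gamma_plus_ge0 gy.
have := ymin _ (Gamma_plus_supp _ _ ag); rewrite wdot_mnm; apply: le_trans.
rewrite /wdot (bigD1 i) //=; apply: (@le_trans _ _ (nat_weight w i * y i)).
  rewrite ler_peMl ?(Gamma_plus_ge0 _ _ _ gy) // /nat_weight.
  by rewrite -[1]/(1%:R) ler_nat.
rewrite lerDl sumr_ge0 // => j _.
by rewrite mulr_ge0 ?ler0n // (Gamma_plus_ge0 _ _ _ gy).
Qed.

(* Perturbing [w] to the positive weight [N w + 1] shows that the minimum of [w]
   is attained on the compact faces. *)
Lemma newton_boundary_wdeg g h w d :
  (forall x, newton_boundary g x -> newton_boundary h x) ->
  (forall b, b \in msupp h -> (d <= wdeg w b)%N) ->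
  forall a, a \in msupp g -> (d <= wdeg w a)%N.
Proof.
move=> gh dmin a ag.
(* [N] exceeds the total degree of [a], so for [b] minimal for [N w + 1] one gets
   [N * wdeg w b < N * (wdeg w a + 1)], that is [wdeg w b <= wdeg w a]. *)
pose N := (mdeg a).+1.
pose w' i := (N * w i + 1)%N.
have w'E c : wdeg w' c = (N * wdeg w c + mdeg c)%N.
  rewrite /wdeg mdegE big_distrr -big_split /=; apply: eq_bigr => i _.
  by rewrite mulnDl mul1n mulnA.
have [b bg bmin] := seq_argmin _ (msupp g) (wdeg w') a ag.
have [|x [_ [_ [gb _]]]] := gh (mnm_real b).
  by apply: newton_boundary_vertex bmin => // i; rewrite /w' addn1.
have := Gamma_plus_wdot _ _ _ _ gb dmin; rewrite wdot_mnm ler_nat => db.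
apply: leq_trans db _; rewrite -ltnS.
have := bmin _ ag; rewrite !w'E => hb.
have {}hb : (N * wdeg w b < N * (wdeg w a).+1)%N.
  rewrite mulnS; apply: leq_ltn_trans (leq_addr _ _) (leq_ltn_trans hb _).
  by rewrite addnC ltn_add2r.
by move: hb; rewrite ltn_pmul2l.
Qed.

(** Allowing a list [s] larger than the support lets the face function of a fibre be summed over the
    exponents of the whole family, some of whose coefficients may vanish at the given parameter. *)
Lemma face_funE g w d (s : seq 'X_{1..n}) :
  (forall b, b \in msupp g -> (d <= wdeg w b)%N) ->
  (exists2 b, b \in msupp g & wdeg w b = d) ->
  uniq s -> {subset msupp g <= s} ->
  face_fun w g = \sum_(a <- s) (if wdeg w a == d then g@_a else 0) *: 'X_[a].
Proof.
move=> dmin dex us gs.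
have -> : face_fun w g = \sum_(a <- msupp g) (if wdeg w a == d then g@_a else 0) *: 'X_[a].
  rewrite /face_fun big_seq [RHS]big_seq; apply: eq_bigr => a ag.
  have h := DeltaP _ _ _ _ ag dmin dex.
  case: ClassicalEpsilon.excluded_middle_informative => [Da|nh]; first by rewrite (h.1 Da) eqxx.
  by case: eqP => [/h//|_]; rewrite scale0r.
rewrite [RHS](bigID (mem (msupp g))) /= [X in _ + X]big1 ?addr0; last first.
  by move=> a ag; rewrite (memN_msupp_eq0 ag) if_same scale0r.
rewrite -[RHS]big_filter; apply: perm_big; apply: uniq_perm.
- exact: msupp_uniq.
- exact: filter_uniq.
- by move=> a; rewrite mem_filter; case: (boolP (a \in msupp g)) => // /gs ->.
Qed.

Lemma meval_lincomb (c : 'X_{1..n} -> R[i]) (s : seq 'X_{1..n}) (z : 'I_n -> R[i]) :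
  (\sum_(a <- s) c a *: 'X_[a]).@[z] = \sum_(a <- s) c a * mon z a.
Proof. by rewrite raddf_sum; apply: eq_bigr => a _; rewrite /= mevalZ mevalX. Qed.

End Newton.

(** The numbers [e / (j + 1)] for [j < size q] are distinct and small; they cannot all be roots of
    [q]. *)
Lemma exists_nonroot {R : realType} (q : {poly R[i]}) (delta : R) : q != 0 -> 0 < delta ->
  exists2 t : R[i], cn2 t < delta & q.[t] != 0.
Proof.
move=> q0 d0; apply: contrapT => nex.
pose e := Num.min 1 (delta / 2).
have e0 : 0 < e by rewrite lt_min ltr01 /=; lra.
have e1 : e <= 1 by rewrite ge_min lexx.
have ed : e < delta.
  have : e <= delta / 2 by rewrite ge_min lexx orbT.
  lra.
pose t (j : nat) : R[i] := (e / j.+1%:R)%:C%C.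
have tq j : root q (t j).
  apply: contrapT => /negP h; apply: nex; exists (t j) => //.
  rewrite cn2_real; apply: le_lt_trans ed.
  have h1 : e / j.+1%:R <= e.
    by rewrite ler_pdivrMr ?ltr0n // ler_peMr ?(ltW e0) // ler1n.
  have h0 : 0 <= e / j.+1%:R by rewrite divr_ge0 ?ler0n ?(ltW e0).
  by apply: (le_trans _ h1); rewrite expr2 ler_piMr // (le_trans h1).
have := @max_poly_roots _ q (map t (iota 0 (size q))) q0.
rewrite size_map size_iota ltnn => h; suff : false by [].
apply: h; first by apply/allP => _ /mapP[j _ ->].
rewrite map_inj_uniq ?iota_uniq // => i j [] /(mulfI (lt0r_neq0 e0)) /invr_inj /eqP.
by rewrite eqr_nat eqSS => /eqP.
Qed.

(** * Row-free Jacobians as linear independence of differentials *)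

Section RowFree.
Context {R : realType} {n : nat} {T : eqType}.
Variables (gs : T -> {mpoly R[i][n]}) (z : 'I_n -> R[i]).

Lemma jac_free (s : seq T) (c : T -> R[i]) :
  uniq s -> row_free (jac [seq gs k | k <- s] z) ->
  (forall i, \sum_(k <- s) c k * (mderiv i (gs k)).@[z] = 0) ->
  forall k, k \in s -> c k = 0.
Proof.
move=> us fr h k ks.
have reindex_map F : \sum_(k <- s) F k =
    \sum_(j < size [seq gs k | k <- s]) F (nth k s j) :> R[i].
  by rewrite (big_nth k) big_mkord size_map.
pose u : 'rV[R[i]]_(size [seq gs k | k <- s]) := \row_j c (nth k s j).
have u0 : u = 0.
  apply/eqP; rewrite -(mulmx_free_eq0 u fr); apply/eqP/rowP => i.
  rewrite !mxE -[RHS](h i) reindex_map.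
  by apply: eq_bigr => j _; rewrite !mxE (nth_map k) // -[X in (_ < X)%N](size_map gs).
have hk : (index k s < size [seq gs k | k <- s])%N by rewrite size_map index_mem.
by have := congr1 (fun v : 'rV_ _ => v 0 (Ordinal hk)) u0; rewrite !mxE /= nth_index.
Qed.

Lemma jac_restr_free (s : seq T) (I : {set 'I_n}) (c : T -> R[i]) :
  uniq s -> row_free (jac_restr [seq gs k | k <- s] I z) ->
  (forall i, i \notin I -> \sum_(k <- s) c k * (mderiv i (gs k)).@[z] = 0) ->
  forall k, k \in s -> c k = 0.
Proof.
move=> us fr h k ks.
have reindex_map F : \sum_(k <- s) F k =
    \sum_(j < size [seq gs k | k <- s]) F (nth k s j) :> R[i].
  by rewrite (big_nth k) big_mkord size_map.
pose u : 'rV[R[i]]_(size [seq gs k | k <- s]) := \row_j c (nth k s j).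
have u0 : u = 0.
  apply/eqP; rewrite -(mulmx_free_eq0 u fr); apply/eqP/rowP => i.
  rewrite !mxE; case: (boolP (i \in I)) => iI.
    by apply: big1 => j _; rewrite !mxE iI mulr0.
  rewrite -[RHS](h i iI) reindex_map.
  apply: eq_bigr => j _; rewrite !mxE (negbTE iI) (nth_map k) //.
  by rewrite -[X in (_ < X)%N](size_map gs).
have hk : (index k s < size [seq gs k | k <- s])%N by rewrite size_map index_mem.
by have := congr1 (fun v : 'rV_ _ => v 0 (Ordinal hk)) u0; rewrite !mxE /= nth_index.
Qed.
End RowFree.

(** * Leading terms *)

Lemma wdeg_eq0 {n} (w : 'I_n -> nat) (a : 'X_{1..n}) :
  (wdeg w a == 0%N) = [forall i, (w i == 0%N) || (a i == 0%N)].
Proof.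
rewrite /wdeg sum_nat_eq0; apply: eq_forallb => i.
by rewrite muln_eq0.
Qed.

Lemma wdeg_neq0 {n} (w : 'I_n -> nat) (a : 'X_{1..n}) :
  wdeg w a != 0%N -> exists2 i, w i != 0%N & a i != 0%N.
Proof.
move=> /eqP wa; apply: contrapT => h; apply: wa; apply: big1 => i _.
case: (eqVneq (w i) 0%N) => [->//|wi]; case: (eqVneq (a i) 0%N) => [->|ai].
  by rewrite muln0.
by case: h; exists i.
Qed.

Section FaceLimits.
Context {R : realType} {n : nat}.

(** An exponent of [F] may be missing at [tau], but it is present at some nearby parameter, and
    constancy of the Newton boundary carries lower bounds on the weight from one fibre to the other.
    So [F] and its fibre at [tau] have the same minimal weight. *)
Lemma newton_min (F : {mpoly {poly R[i]}[n]}) (delta : R) (tau : R[i]) (w : 'I_n -> nat) :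
  F != 0 -> 0 < delta ->
  (forall t t' : R[i], cn2 t < delta -> cn2 t' < delta -> forall x,
     newton_boundary (fiberp F t) x <-> newton_boundary (fiberp F t') x) ->
  cn2 tau < delta ->
  exists2 a, a \in msupp (fiberp F tau) &
    forall b, b \in msupp F -> (wdeg w a <= wdeg w b)%N.
Proof.
move=> F0 d0 nb td.
have lift d : (forall b, b \in msupp (fiberp F tau) -> (d <= wdeg w b)%N) ->
    forall b, b \in msupp F -> (d <= wdeg w b)%N.
  move=> dmin b; rewrite mcoeff_msupp => /exists_nonroot/(_ d0)[t td' tb].
  apply: (newton_boundary_wdeg (fiberp F t) (fiberp F tau)) dmin _ _ => [x|].
    by case: (nb t tau td' td x).
  by rewrite mcoeff_msupp mcoeff_fiberp.
(* An empty support would make every [d] a lower bound, in particular one more than the weight of an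
   exponent of [F]. *)
case E : (msupp (fiberp F tau)) => [|a s].
  case E' : (msupp F) => [|b s']; first by move: F0; rewrite -msupp_eq0 E'.
  have : ((wdeg w b).+1 <= wdeg w b)%N.
    by apply: lift => [c|]; rewrite ?E ?E' ?mem_head.
  by rewrite ltnn.
have at' : a \in msupp (fiberp F tau) by rewrite E mem_head.
have [b bt bmin] := seq_argmin _ (msupp (fiberp F tau)) (wdeg w) a at'.
by exists b; [rewrite -E | exact: lift].
Qed.

Context {U : (nat -> Prop) -> Prop} (uU : ultra U).
Variables (x : nat -> pt R n) (tau : R[i]) (J : {set 'I_n}) (D : seq 'X_{1..n}).
Variables (w : 'I_n -> nat) (zt : 'I_n -> R[i]).
Hypothesis xt : ulim U (fun m => (x m).1) tau.
Hypothesis zt0 : in_torus zt.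
Hypothesis wJ : forall a b, a \in D -> b \in D -> (forall i, i \notin J -> b i = 0%N) ->
  (exists2 i, i \notin J & a i != 0%N) -> (wdeg w b < wdeg w a)%N.
Hypothesis wlim : forall a b, a \in D -> b \in D -> (forall i, i \notin J -> b i = 0%N) ->
  (wdeg w a = wdeg w b ->
     ulim U (fun m => mon (x m).2 a / mon (x m).2 b) (mon zt a / mon zt b)) /\
  ((wdeg w b < wdeg w a)%N ->
     ulim U (fun m => mon (x m).2 a / mon (x m).2 b) 0).

(** After division by a monomial of least weight, the terms of larger weight tend to 0 and the
    others tend to their values at [zt]. The coefficients [c] are arbitrary, so this applies to [F]
    and to all its derivatives. *)
Lemma leading_limit (c : 'X_{1..n} -> {poly R[i]}) (s : seq 'X_{1..n}) (b : 'X_{1..n}) :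
  {subset s <= D} -> b \in D -> (forall i, i \notin J -> b i = 0%N) ->
  (forall a, a \in s -> (wdeg w b <= wdeg w a)%N) ->
  ulim U (fun m => (\sum_(a <- s) (c a).[(x m).1] * mon (x m).2 a) / mon (x m).2 b)
    ((\sum_(a <- s) (if wdeg w a == wdeg w b then (c a).[tau] else 0) * mon zt a) / mon zt b).
Proof.
move=> sD bD bJ bmin; rewrite mulr_suml.
apply: (ulim_ext uU (fun m => \sum_(a <- s)
  (c a).[(x m).1] * (mon (x m).2 a / mon (x m).2 b))).
  by move=> m; rewrite mulr_suml; apply: eq_bigr => a _; rewrite mulrA.
apply: (ulim_sum uU) => a sa; have [h1 h2] := wlim a b (sD _ sa) bD bJ.
have hc := ulim_horner uU (c a) _ _ xt.
case: eqP => [/h1 h|/eqP ab]; first by rewrite -mulrA; apply: (ulim_mul uU).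
rewrite !mul0r -(mulr0 (c a).[tau]); apply: (ulim_mul uU) => //; apply: h2.
by rewrite ltn_neqAle eq_sym ab bmin.
Qed.

(** The monomial of [b] measures the size of [F] and of its logarithmic derivatives. It also bounds
    the [t]-derivative, because [b] is minimal over all exponents of [F]. The last two clauses are
    Euler's identity and the fact that a face of weight 0 involves only variables of weight 0. *)
Lemma face_limits (F : {mpoly {poly R[i]}[n]}) (delta : R) :
  {subset msupp F <= D} ->
  (exists2 a, a \in msupp F & forall i, i \notin J -> a i = 0%N) ->
  F != 0 -> 0 < delta ->
  (forall t t' : R[i], cn2 t < delta -> cn2 t' < delta -> forall y,
     newton_boundary (fiberp F t) y <-> newton_boundary (fiberp F t') y) ->
  cn2 tau < delta ->
  let face := face_fun w (fiberp F tau) in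
  exists b,
    [/\ b \in msupp F, forall i, i \notin J -> b i = 0%N
      & forall a, a \in msupp F -> (wdeg w b <= wdeg w a)%N] /\
    [/\ ulim U (fun m => evalF F (x m) / mon (x m).2 b) (face.@[zt] / mon zt b),
        forall i, ulim U (fun m => (x m).2 i * (gradF F (x m)).2 i / mon (x m).2 b)
          (zt i * (mderiv i face).@[zt] / mon zt b),
        exists e, ulim U (fun m => (gradF F (x m)).1 / mon (x m).2 b) e,
        \sum_i (w i)%:R * (zt i * (mderiv i face).@[zt]) = (wdeg w b)%:R * face.@[zt]
      & wdeg w b = 0%N -> forall i, w i != 0%N -> (mderiv i face).@[zt] = 0].
Proof.
move=> FD [a1 a1F a1J] F0 d0 nb td face.
have [b bt bmin] := newton_min F delta tau w F0 d0 nb td.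
have bF := msupp_fiberp _ _ _ bt.
(* Otherwise [b] would be strictly heavier than the exponent [a1] supported in [J], against
   minimality. *)
have bJ i : i \notin J -> b i = 0%N.
  move=> iJ; apply/eqP; apply: contrapT => /negP bi.
  have := wJ _ _ (FD _ bF) (FD _ a1F) a1J (ex_intro2 _ _ i iJ bi).
  by rewrite ltnNge bmin.
have fE : face = \sum_(a <- msupp F) (if wdeg w a == wdeg w b then (F@_a).[tau] else 0) *: 'X_[a].
  rewrite /face (face_funE _ w (wdeg w b) (msupp F)).
  - by apply: eq_bigr => a _; rewrite mcoeff_fiberp.
  - by move=> a /msupp_fiberp; apply: bmin.
  - by exists b.
  - exact: msupp_uniq.
  - by move=> a; apply: msupp_fiberp.
have lim c := leading_limit c _ b FD (FD _ bF) bJ bmin.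
exists b; split=> //; split.
- rewrite fE meval_lincomb; apply: (ulim_ext uU _ _ _ _ (lim (fun a => F@_a))) => m.
  by rewrite evalFE.
- move=> i; rewrite fE mderiv_monE.
  have -> : \sum_(a <- msupp F) (a i)%:R *
      ((if wdeg w a == wdeg w b then (F@_a).[tau] else 0) * mon zt a) =
      \sum_(a <- msupp F) (if wdeg w a == wdeg w b then (F@_a *+ a i).[tau] else 0) * mon zt a.
    apply: eq_bigr => a _; rewrite mulrA; congr (_ * _).
    by case: ifP => _; rewrite ?mulr0 // hornerMn mulr_natl.
  apply: (ulim_ext uU _ _ _ _ (lim (fun a => F@_a *+ a i))) => m.
  rewrite gradF_zE; congr (_ / _); apply: eq_bigr => a _.
  by rewrite hornerMn -mulr_natl mulrA.
- eexists; apply: (ulim_ext uU _ _ _ _ (lim (fun a => (F@_a)^`()))) => m.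
  by congr (_ / _); apply/esym; exact: gradF_tE.
- rewrite fE meval_lincomb mulr_sumr.
  under eq_bigr => i _ do rewrite mderiv_monE mulr_sumr.
  rewrite exchange_big; apply: eq_bigr => a _ /=.
  case: eqP => [<-|_]; last first.
    by rewrite mul0r mulr0; apply: big1 => i _; rewrite !mulr0.
  rewrite /wdeg natr_sum mulr_suml; apply: eq_bigr => i _.
  by rewrite natrM mulrA.
- move=> b0 i wi; apply: (mulfI (x := zt i)); first by apply/eqP; exact: zt0.
  rewrite mulr0 fE mderiv_monE big1 // => a _.
  rewrite b0; case: eqP => [/eqP|_]; last by rewrite mul0r mulr0.
  by rewrite wdeg_eq0 => /forallP/(_ i); rewrite (negbTE wi) => /eqP ->; rewrite mul0r.
Qed.
End FaceLimits.

(** * Normalising coefficient sequences *)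

Section Normalise.
Context {R : realType} {U : (nat -> Prop) -> Prop} (uU : ultra U) {k0 : nat}.
Variable N : nat -> 'I_k0 -> R[i].

Lemma norm_pick (k : 'I_k0) : exists kx, U (fun m => forall j, cn2 (N m j) <= cn2 (N m kx)).
Proof.
apply: (ultra_pick uU); apply: (ultraT uU) => m.
by case: (@arg_maxP _ _ _ k xpredT (fun j => cn2 (N m j))) => // j _ h; exists j => l; apply: h.
Qed.

Lemma ratio_limits kx : U (fun m => forall j, cn2 (N m j) <= cn2 (N m kx)) ->
  U (fun m => N m kx != 0) ->
  exists nu : 'I_k0 -> R[i], nu kx = 1 /\ forall j, ulim U (fun m => N m j / N m kx) (nu j).
Proof.
move=> hmax h0.
have /choice[nu hnu] : forall j, exists l, ulim U (fun m => N m j / N m kx) l.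
  move=> j; apply: (ulim_exists uU _ 1); apply: (ultraS2 uU _ _ _ hmax h0) => m h1 h2.
  by rewrite cn2M cn2V ler_pdivrMr ?cn2_gt0 // mul1r.
exists nu; split=> //; apply: (ulim_uniq uU _ _ _ (hnu kx)).
apply: (ulim_near uU _ _ _ _ (ulim_cst uU 1)).
by apply: (ultraS _ uU _ _ h0) => m h; rewrite divff.
Qed.

(** If the largest coefficient is bounded, all of them converge unscaled. Otherwise dividing by it
    sends the scale [sg] to 0 and keeps a limit coefficient equal to 1. The argument [k] only
    witnesses that there is an index. *)
Lemma normalise (k : 'I_k0) : exists (sg : nat -> R[i]) (sg0 : R[i]) (nu : 'I_k0 -> R[i]),
  [/\ ulim U sg sg0, forall j, ulim U (fun m => sg m * N m j) (nu j)
    & sg0 = 1 \/ sg0 = 0 /\ exists j, nu j != 0].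
Proof.
have [kx hmax] := norm_pick k.
have [[M hM]|nM] := pselect (exists M, U (fun m => cn2 (N m kx) <= M)).
  have /choice[nu hnu] : forall j, exists l, ulim U (fun m => N m j) l.
    move=> j; apply: (ulim_exists uU _ M); apply: (ultraS2 uU _ _ _ hmax hM) => m h1.
    exact: le_trans (h1 j).
  exists (fun=> 1), 1, nu; split; [exact: ulim_cst| |by left].
  by move=> j; apply: (ulim_ext uU _ _ _ _ (hnu j)) => m; rewrite mul1r.
have big M : U (fun m => M < cn2 (N m kx)).
  have hn : ~ U (fun m => cn2 (N m kx) <= M) by move=> hM; apply: nM; exists M.
  by apply: (ultraS _ uU _ _ (ultra_not uU _ hn)) => m /negP; rewrite -ltNge.
have N0 : U (fun m => N m kx != 0).
  by apply: (ultraS _ uU _ _ (big 0)) => m; apply: contraTneq => ->; rewrite cn20 ltxx.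
have [nu [nux hnu]] := ratio_limits kx hmax N0.
exists (fun m => (N m kx)^-1), 0, nu; split.
- move=> e e0; apply: (ultraS _ uU _ _ (big e^-1)) => m h.
  rewrite subr0 cn2V invf_plt ?posrE //.
  by apply: lt_trans h; rewrite invr_gt0.
- by move=> j; apply: (ulim_ext uU _ _ _ _ (hnu j)) => m; rewrite mulrC.
- by right; split=> //; exists kx; rewrite nux oner_neq0.
Qed.
End Normalise.

(** * Families *)

Lemma norm2E {R : realType} {n} (x : pt R n) : norm2 x = cn2 x.1 + \sum_i cn2 (x.2 i).
Proof.
by rewrite /norm2 /dist2 /= subr0; congr (_ + _); apply: eq_bigr => i _; rewrite subr0.
Qed.

Lemma cn2_le_norm2 {R : realType} {n} (x : pt R n) :
  cn2 x.1 <= norm2 x /\ forall i, cn2 (x.2 i) <= norm2 x.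
Proof.
rewrite norm2E; split=> [|i].
  by rewrite lerDl sumr_ge0 // => i _; apply: cn2_ge0.
rewrite (bigD1 i) //= addrCA lerDl addr_ge0 ?cn2_ge0 // sumr_ge0 // => j _.
exact: cn2_ge0.
Qed.

Section Family.
Context {R : realType} {n k0 : nat}.
Variables (f : 'I_k0 -> {mpoly {poly R[i]}[n]}) (Rr delta : R).
Hypothesis d0 : 0 < delta.
Hypothesis f0 : forall k, f k != 0.
Hypothesis fnb : forall (k : 'I_k0) (t t' : R[i]), cn2 t < delta -> cn2 t' < delta ->
  forall x, newton_boundary (fiberp (f k) t) x <-> newton_boundary (fiberp (f k) t') x.
Hypothesis fadm : forall t : R[i], cn2 t < delta ->
  forall K : {set 'I_k0}, K != set0 ->
    nondegenerate_ci [seq fiberp (f k) t | k <- enum K] /\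
    exists R' : R, Rr < R' /\ tame_radius [seq fiberp (f k) t | k <- enum K] R'.

Lemma nth_fiberp t (K : {set 'I_k0}) (P : {mpoly R[i][n]} -> Prop) :
  (forall k, k \in K -> P (fiberp (f k) t)) ->
  forall j, (j < size [seq fiberp (f k) t | k <- enum K])%N ->
    P ([seq fiberp (f k) t | k <- enum K]`_j).
Proof.
move=> h j; rewrite size_map => jK.
have k1 : 'I_k0 by case: (enum K) jK => [|k ?].
by rewrite (nth_map k1) //; apply: h; rewrite -mem_enum mem_nth.
Qed.

Lemma nondegenerate_free t (K : {set 'I_k0}) w zt (c : 'I_k0 -> R[i]) :
  cn2 t < delta -> (forall i, w i != 0%N) -> in_torus zt ->
  (forall k, k \in K -> (face_fun w (fiberp (f k) t)).@[zt] = 0) ->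
  (forall i, \sum_(k in K) c k * (mderiv i (face_fun w (fiberp (f k) t))).@[zt] = 0) ->
  forall k, k \in K -> c k = 0.
Proof.
move=> td w0 z0 fz fc k kK.
have [|nd _] := fadm t td K; first by apply/set0Pn; exists k.
have w0' i : (0 < w i)%N by rewrite lt0n.
have := nd w w0' zt z0 (nth_fiberp t K (fun g => (face_fun w g).@[zt] = 0) fz).
rewrite -map_comp => /(jac_free (face_fun w \o (fun k => fiberp (f k) t)) zt).
move=> /(_ c (enum_uniq _)); apply; last by rewrite mem_enum.
by move=> i; rewrite big_enum; exact: fc.
Qed.

Lemma tame_free t (K : {set 'I_k0}) (I : {set 'I_n}) w zt (c : 'I_k0 -> R[i]) :
  cn2 t < delta -> I != set0 -> (forall i, (w i == 0%N) = (i \in I)) ->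
  (exists i, w i != 0%N) -> in_torus zt -> \sum_(i in I) cn2 (zt i) < Rr ->
  (forall k, k \in K -> vanishes_on_coord (fiberp (f k) t) I) ->
  (forall k, k \in K -> (face_fun w (fiberp (f k) t)).@[zt] = 0) ->
  (forall i, i \notin I ->
     \sum_(k in K) c k * (mderiv i (face_fun w (fiberp (f k) t))).@[zt] = 0) ->
  forall k, k \in K -> c k = 0.
Proof.
move=> td I0 wI [i1 wi1] z0 zR van fz fc k kK.
have [|_ [R' [RR' tame]]] := fadm t td K; first by apply/set0Pn; exists k.
have := tame I I0 (nth_fiberp t K (fun g => vanishes_on_coord g I) van) w.
have ex : exists i, w i <> 0%N by exists i1; apply/eqP.
have wI' i : w i = 0%N <-> i \in I by rewrite -wI; split=> /eqP.
move=> /(_ ex wI' zt z0 (lt_trans zR RR')).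
move=> /(_ (nth_fiberp t K (fun g => (face_fun w g).@[zt] = 0) fz)).
rewrite -map_comp => /(jac_restr_free (face_fun w \o (fun k => fiberp (f k) t)) zt).
move=> /(_ c (enum_uniq _)); apply; last by rewrite mem_enum.
by move=> i iI; rewrite big_enum; exact: fc.
Qed.

Let D := flatten [seq msupp (f k) | k <- enum 'I_k0].

Lemma sub_allsupp k : {subset msupp (f k) <= D}.
Proof. by move=> a ak; apply/flatten_mapP; exists k; rewrite ?mem_enum. Qed.

(** Counterexamples at radii [1 / (m + 1)] would form a sequence tending to the origin. There all
    limit weights are positive, and the rescaled relations converge to a nontrivial relation between
    the differentials of face functions vanishing at [zt], against non-degeneracy at [t = 0]. *)
Lemma coord_independent : exists eps : R, 0 < eps /\
  forall p : pt R n, norm2 p < eps -> forall nu : 'I_k0 -> R[i],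
    (forall k, nu k != 0 -> evalF (f k) p = 0 /\
       exists2 a, a \in msupp (f k) & forall i, p.2 i = 0 -> a i = 0%N) ->
    (forall i, p.2 i != 0 -> \sum_k nu k * (gradF (f k) p).2 i = 0) ->
    forall k, nu k = 0.
Proof.
apply: contrapT => nex.
have /choice[y hy] : forall m : nat, exists y : pt R n * ('I_k0 -> R[i]),
    [/\ norm2 y.1 < m.+1%:R^-1,
      forall k, y.2 k != 0 -> evalF (f k) y.1 = 0 /\
         exists2 a, a \in msupp (f k) & forall i, y.1.2 i = 0 -> a i = 0%N,
      forall i, y.1.2 i != 0 -> \sum_k y.2 k * (gradF (f k) y.1).2 i = 0
      & exists k, y.2 k != 0].
  move=> m; apply: contrapT => ny; apply: nex; exists m.+1%:R^-1.
  split; first by rewrite invr_gt0 ltr0n.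
  move=> p pm nu h1 h2 k; apply/eqP; apply: contrapT => /negP nk.
  by apply: ny; exists (p, nu); split=> //; exists k.
have [U uU] := ultra_exists.
pose x m := (y m).1; pose nu m := (y m).2.
have small e : 0 < e -> U (fun m => norm2 (x m) < e).
  move=> e0; have [N hN] : exists N : nat, e^-1 < N%:R.
    by exists (Num.bound e^-1); apply: archi_boundP; rewrite invr_ge0 ltW.
  apply: (ultraS _ uU _ _ (ultra_ge _ uU N)) => m Nm.
  have [h _ _ _] := hy m; apply: lt_trans h _.
  rewrite invf_plt ?posrE ?ltr0n //; apply: lt_trans hN _.
  by rewrite ltr_nat ltnS.
have xt : ulim U (fun m => (x m).1) 0.
  move=> e e0; apply: (ultraS _ uU _ _ (small e e0)) => m; rewrite subr0.
  exact: le_lt_trans (cn2_le_norm2 _).1.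
have xz i : ulim U (fun m => (x m).2 i) 0.
  move=> e e0; apply: (ultraS _ uU _ _ (small e e0)) => m; rewrite subr0.
  exact: le_lt_trans ((cn2_le_norm2 _).2 i).
have [J xJ] : exists J, U (fun m => [set i | (x m).2 i != 0] = J).
  by apply: (ultra_pick uU); apply: (ultraT uU) => m; eexists.
have [K nuK] : exists K, U (fun m => [set k | nu m k != 0] = K).
  by apply: (ultra_pick uU); apply: (ultraT uU) => m; eexists.
have xJ0 : U (fun m => forall i, ((x m).2 i == 0) = (i \notin J)).
  by apply: (ultraS _ uU _ _ xJ) => m <- i; rewrite inE negbK.
have [w [zt [zt0 wq _ wJ wlim]]] := toric_limit uU _ (fun=> 0) J D xz xJ0.
have w0 i : w i != 0%N by rewrite wq eqxx.
have t0 : cn2 (0 : R[i]) < delta by rewrite cn20.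
pose face k := face_fun w (fiberp (f k) 0).
have /choice[b hb] : forall k, exists b : 'X_{1..n}, k \in K ->
    [/\ forall i, i \notin J -> b i = 0%N,
        ulim U (fun m => evalF (f k) (x m) / mon (x m).2 b) ((face k).@[zt] / mon zt b)
      & forall i, ulim U (fun m => (x m).2 i * (gradF (f k) (x m)).2 i / mon (x m).2 b)
          (zt i * (mderiv i (face k)).@[zt] / mon zt b)].
  move=> k; case: (boolP (k \in K)) => kK; last by exists 0%MM.
  have [m [Jm Km]] := ultra_ex uU _ (ultraI _ uU _ _ xJ nuK).
  have supp : exists2 a, a \in msupp (f k) & forall i, i \notin J -> a i = 0%N.
    have [_ h _ _] := hy m; have nk : (y m).2 k != 0 by move: kK; rewrite -Km inE.
    have [_ [a ak ha]] := h k nk; exists a => // i; rewrite -Jm inE negbK => /eqP.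
    exact: ha.
  have [c [[ck cJ _] [c1 c2 _ _ _]]] := face_limits uU _ _ _ _ _ _ xt zt0 wJ wlim
    (f k) delta (sub_allsupp k) supp (f0 k) d0 (fnb k) t0.
  by exists c.
(* Multiplying [nu] by the size of [f k] makes the other factor of each term, the logarithmic
   derivative divided by that size, convergent. *)
pose N m k := nu m k * mon (x m).2 (b k).
have [m0 [Km0 _]] := ultra_ex uU _ (ultraI _ uU _ _ nuK nuK).
have [_ _ _ [k1 _]] := hy m0.
have [kx hmax] := norm_pick uU N k1.
have mon0 k : k \in K -> U (fun m => mon (x m).2 (b k) != 0).
  move=> /hb[bJ _ _]; apply: (ultraS _ uU _ _ xJ0) => m h; apply: mon_neq0 => i bi.
  by rewrite h; apply/negPn; apply: contraNT bi => /bJ ->.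
have monK : U (fun m => forall k, k \in K -> mon (x m).2 (b k) != 0).
  apply: (ultra_fin uU) => k; case: (boolP (k \in K)) => [/mon0 h|_].
    by apply: (ultraS _ uU _ _ h).
  exact: (ultraT uU).
have N0 : U (fun m => N m kx != 0).
  apply: (ultraS2 uU _ _ _ (ultraI _ uU _ _ monK nuK) hmax) => m [h2 Km] h3.
  have [_ _ _ [k nk]] := hy m.
  have kK : k \in K by rewrite -Km inE.
  rewrite -cn2_eq0 gt_eqF //; apply: lt_le_trans (h3 k); apply: cn2_gt0.
  by rewrite mulf_neq0 // h2.
have [nu0 [nu0x hnu0]] := ratio_limits uU N kx hmax N0.
have kxK : kx \in K.
  have [m [Km Nm]] := ultra_ex uU _ (ultraI _ uU _ _ nuK N0).
  by rewrite -Km inE; apply: contraNneq Nm => h; rewrite /N h mul0r.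
have face0 k : k \in K -> (face k).@[zt] = 0.
  move=> kK; have [_ h _] := hb k kK.
  have e : (face k).@[zt] / mon zt (b k) = 0.
    apply: (ulim_uniq uU _ _ _ h); apply: (ulim_near uU _ _ _ _ (ulim_cst uU 0)).
    apply: (ultraS _ uU _ _ nuK) => m Km; have [_ h' _ _] := hy m.
    have [|-> _] := h' k; first by move: kK; rewrite -Km inE.
    by rewrite mul0r.
  apply: (mulIf (x := (mon zt (b k))^-1)); last by rewrite e mul0r.
  by rewrite invr_eq0 mon_neq0 // => i _; apply/eqP; exact: zt0.
(* The relation along the sequence, multiplied by the [i]-th coordinate and divided by the largest
   coefficient; where that coordinate vanishes the product is trivially 0. *)
have rel i : \sum_(k in K) nu0 k * (zt i * (mderiv i (face k)).@[zt] / mon zt (b k)) = 0.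
  rewrite -big_enum; apply: (ulim_uniq uU (fun m => \sum_(k <- enum K) N m k / N m kx *
      ((x m).2 i * (gradF (f k) (x m)).2 i / mon (x m).2 (b k)))).
    apply: (ulim_sum uU) => k; rewrite mem_enum => kK; apply: (ulim_mul uU) => //.
    by case: (hb k kK).
  apply: (ulim_near uU _ _ _ _ (ulim_cst uU 0)).
  apply: (ultraS2 uU _ _ _ monK nuK) => m h2 Km; apply/esym.
  have -> : \sum_(k <- enum K) N m k / N m kx *
      ((x m).2 i * (gradF (f k) (x m)).2 i / mon (x m).2 (b k)) =
      (x m).2 i / N m kx * \sum_(k in K) nu m k * (gradF (f k) (x m)).2 i.
    rewrite big_enum mulr_sumr; apply: eq_bigr => k kK.
    rewrite /N; move: (h2 k kK) (gradF _ _) (_^-1) => c0 g u.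
    by field.
  case: (eqVneq ((x m).2 i) 0) => [->|xi]; first by rewrite !mul0r.
  have [_ _ h3 _] := hy m; have := h3 i xi; rewrite (bigID (mem K)) /=.
  rewrite [X in _ + X]big1 ?addr0 => [->|k kK]; first by rewrite mulr0.
  suff -> : (y m).2 k = 0 by rewrite mul0r.
  by apply/eqP; move: kK; rewrite -Km inE negbK.
have : nu0 kx / mon zt (b kx) = 0.
  apply: (nondegenerate_free 0 K w zt (fun k => nu0 k / mon zt (b k))) => // i.
  apply: (mulfI (x := zt i)); first by apply/eqP; exact: zt0.
  rewrite mulr0 -[RHS](rel i) mulr_sumr; apply: eq_bigr => k _.
  by rewrite /face; ring.
move=> /eqP; rewrite nu0x mul1r invr_eq0; apply/negP; apply: mon_neq0 => i _.
by apply/eqP; exact: zt0.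
Qed.

(** * The limit of the conormal covectors *)

Context {U : (nat -> Prop) -> Prop} (uU : ultra U).
Variables (x : nat -> pt R n) (p : pt R n) (lam : nat -> R[i]) (a : pt R n).
Hypothesis pd : cn2 p.1 < delta.
Hypothesis pR : \sum_i cn2 (p.2 i) < Rr.
Hypothesis ind : forall nu : 'I_k0 -> R[i],
  (forall k, nu k != 0 -> evalF (f k) p = 0 /\
     exists2 b, b \in msupp (f k) & forall i, p.2 i = 0 -> b i = 0%N) ->
  (forall i, p.2 i != 0 -> \sum_k nu k * (gradF (f k) p).2 i = 0) ->
  forall k, nu k = 0.
Hypothesis xt : ulim U (fun m => (x m).1) p.1.
Hypothesis xz : forall i, ulim U (fun m => (x m).2 i) (p.2 i).
Let F := \prod_k f k.
Hypothesis Fx : forall m, evalF F (x m) != 0.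
Hypothesis at_ : ulim U (fun m => lam m * (gradF F (x m)).1) a.1.
Hypothesis az : forall i, ulim U (fun m => lam m * (gradF F (x m)).2 i) (a.2 i).
Variable k1 : 'I_k0.
Hypothesis fk1 : evalF (f k1) p = 0.

(** The components of [a] along coordinates vanishing at [p] are left free: tangent vectors of the
    stratum are zero there. *)
Lemma conormal_limit : exists nu : 'I_k0 -> R[i],
  [/\ forall k, nu k != 0 -> evalF (f k) p = 0,
      a.1 = \sum_k nu k * (gradF (f k) p).1
    & forall i, p.2 i != 0 -> a.2 i = \sum_k nu k * (gradF (f k) p).2 i].
Proof.
have [J xJ] : exists J, U (fun m => [set i | (x m).2 i != 0] = J).
  by apply: (ultra_pick uU); apply: (ultraT uU) => m; eexists.
have xJ0 : U (fun m => forall i, ((x m).2 i == 0) = (i \notin J)).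
  by apply: (ultraS _ uU _ _ xJ) => m <- i; rewrite inE negbK.
have [w [zt [zt0 wq ztq wJ wlim]]] := toric_limit uU _ p.2 J D xz xJ0.
have zt0' i : zt i != 0 by apply/eqP; exact: zt0.
have mzt b : mon zt b != 0 by apply: mon_neq0.
pose face k := face_fun w (fiberp (f k) p.1).
have fx m k : evalF (f k) (x m) != 0.
  have := Fx m; rewrite /F evalF_prod => /prodf_neq0; exact.
have supp k : exists2 b, b \in msupp (f k) & forall i, i \notin J -> b i = 0%N.
  have [m Jm] := ultra_ex uU _ xJ.
  apply: contrapT => nb; have /eqP := fx m k; apply; rewrite evalFE.
  rewrite big_seq; apply: big1 => b bk.
  have [[i iJ bi]|h] := pselect (exists2 i, i \notin J & b i != 0%N).
    have xi : (x m).2 i = 0 by apply/eqP; move: iJ; rewrite -Jm inE negbK.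
    by rewrite (mon_eq0 _ _ i xi bi) mulr0.
  exfalso; apply: nb; exists b => // i iJ; apply/eqP; apply: contrapT => /negP bi.
  by apply: h; exists i.
have /choice[b hb] : forall k, exists b : 'X_{1..n},
    [/\ b \in msupp (f k), forall i, i \notin J -> b i = 0%N
      & forall c, c \in msupp (f k) -> (wdeg w b <= wdeg w c)%N] /\
    [/\ ulim U (fun m => evalF (f k) (x m) / mon (x m).2 b) ((face k).@[zt] / mon zt b),
        forall i, ulim U (fun m => (x m).2 i * (gradF (f k) (x m)).2 i / mon (x m).2 b)
          (zt i * (mderiv i (face k)).@[zt] / mon zt b),
        exists e, ulim U (fun m => (gradF (f k) (x m)).1 / mon (x m).2 b) e,
        \sum_i (w i)%:R * (zt i * (mderiv i (face k)).@[zt]) = (wdeg w b)%:R * (face k).@[zt]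
      & wdeg w b = 0%N -> forall i, w i != 0%N -> (mderiv i (face k)).@[zt] = 0].
  move=> k.
  exact: (face_limits uU _ _ _ _ _ _ xt zt0 wJ wlim (f k) delta
    (sub_allsupp k) (supp k) (f0 k) d0 (fnb k) pd).
pose s k m := mon (x m).2 (b k).
pose g k := (face k).@[zt] / mon zt (b k).
pose h k i := zt i * (mderiv i (face k)).@[zt] / mon zt (b k).
pose d k := wdeg w (b k).
have sN0 : U (fun m => forall k, s k m != 0).
  apply: (ultraS _ uU _ _ xJ0) => m hm k; apply: mon_neq0 => i bi; rewrite hm.
  by apply/negPn; apply: contraNT bi => iJ; case: (hb k) => -[_ -> //].
(* By the product rule these are the coefficients of the differentials of the [f k];
   [mu k m * evalF (f k) (x m)] is the same for all [k]. *)
pose mu k m := lam m * \prod_(j | j != k) evalF (f j) (x m).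
have muf k m : mu k m * evalF (f k) (x m) = lam m * evalF F (x m).
  by rewrite /F evalF_prod [in RHS](bigD1 k) //= /mu; ring.
have [gt gz] : (forall m, lam m * (gradF F (x m)).1 = \sum_k mu k m * (gradF (f k) (x m)).1) /\
    (forall m i, lam m * (gradF F (x m)).2 i = \sum_k mu k m * (gradF (f k) (x m)).2 i).
  split=> m; have [e1 e2] := gradF_prod f (x m).
    apply: (etrans (congr1 (fun c => lam m * c) e1)).
    by rewrite mulr_sumr; apply: eq_bigr => k _; rewrite mulrA.
  move=> i; apply: (etrans (congr1 (fun c => lam m * c) (e2 i))).
  by rewrite mulr_sumr; apply: eq_bigr => k _; rewrite mulrA.
have [sg [sg0 [nu [hsg hnu sgnu]]]] := normalise uU (fun m k => mu k m * s k m) k1.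
have [c0 hc0] : exists c0, forall k, nu k * g k = c0.
  exists (nu k1 * g k1) => k.
  have lim j : ulim U (fun m => sg m * (lam m * evalF F (x m))) (nu j * g j).
    have [_ [hg _ _ _ _]] := hb j.
    apply: (ulim_near uU _ _ _ _ (ulim_mul uU _ _ _ _ (hnu j) hg)).
    apply: (ultraS _ uU _ _ sN0) => m /(_ j) sj.
    by rewrite -(muf j m) -/(s j m); move: (evalF (f j)) => e; field.
  exact: ulim_uniq (lim k) (lim k1).
have qw i : (p.2 i == 0) = (w i != 0%N) by rewrite wq negbK.
(* The component [a.2 i] is finite and the coordinate tends to 0, so the [i]-th logarithmic
   component of the covector disappears in the limit. *)
have rel i : p.2 i = 0 -> \sum_k nu k * h k i = 0.
  move=> pi.
  apply: (ulim_uniq uU (fun m => sg m * ((x m).2 i * (lam m * (gradF F (x m)).2 i)))).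
    apply: (ulim_near uU _ _ _ _ (ulim_sum uU _ (index_enum 'I_k0) _ _
      (fun k _ => ulim_mul uU _ _ _ _ (hnu k) (let: conj _ (And5 _ e _ _ _) := hb k in e i)))).
    apply: (ultraS _ uU _ _ sN0) => m sm; rewrite gz !mulr_sumr; apply: eq_bigr => k _.
    by rewrite -/(s k m); have := sm k; move: (gradF (f k)) => e sk; field.
  have := ulim_mul uU _ _ _ _ hsg (ulim_mul uU _ _ _ _ (xz i) (az i)).
  by rewrite pi mul0r mulr0.
have mq k : d k = 0%N -> mon p.2 (b k) != 0.
  move=> dk; apply: mon_neq0 => i; rewrite qw.
  by have := wdeg_eq0 w (b k); rewrite -/(d k) dk => /esym/forallP/(_ i)/orP[/eqP->|/eqP->].
have limq k : ulim U (s k) (mon p.2 (b k)) by exact: ulim_mon.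
have gq k : d k = 0%N -> g k = evalF (f k) p / mon p.2 (b k).
  move=> dk; have [_ [hg _ _ _ _]] := hb k; apply: (ulim_uniq uU _ _ _ hg).
  apply: (ulim_div uU); [exact: mq | exact: ulim_evalF | exact: limq].
have vanish c : wdeg w c != 0%N -> forall z : 'I_n -> R[i],
    (forall i, w i != 0%N -> z i = 0) -> mon z c = 0.
  move=> /wdeg_neq0[i wi ci] z hz.
  exact: mon_eq0 (hz i wi) ci.
have fk0 k : d k != 0%N -> evalF (f k) p = 0.
  move=> dk; rewrite evalFE big_seq; apply: big1 => c ck; rewrite (vanish c) ?mulr0 //.
    have [[_ _ /(_ c ck) hc] _] := hb k.
    by rewrite -lt0n; apply: leq_trans hc; rewrite lt0n.
  by move=> i wi; apply/eqP; rewrite qw.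
(* Summing the relations with weights [w i] and applying Euler's identity gives [c0] times the sum
   of the [d k]. If all [d k] are 0, then [g k1] is proportional to the value of [f k1] at [p],
   which is 0. *)
have c00 : c0 = 0.
  have e : c0 * (\sum_k d k)%:R = 0.
    have : \sum_i (w i)%:R * (\sum_k nu k * h k i) = 0.
      apply: big1 => i _; case: (eqVneq (w i) 0%N) => [->|wi]; first by rewrite mul0r.
      by rewrite rel ?mulr0 //; apply/eqP; rewrite qw.
    move=> <-; rewrite natr_sum mulr_sumr.
    under [RHS]eq_bigr => i _ do rewrite mulr_sumr.
    rewrite exchange_big; apply: eq_bigr => k _ /=.
    have [_ [_ _ _ euler _]] := hb k.
    rewrite -(hc0 k) /g -/(d k).
    transitivity (nu k / mon zt (b k) * ((d k)%:R * (face k).@[zt])); first by ring.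
    rewrite -euler mulr_sumr; apply: eq_bigr => i _; rewrite /h; ring.
  case: (eqVneq (\sum_k d k)%N 0%N) => [/eqP|sd]; last first.
    by apply/eqP; move/eqP: e; rewrite mulf_eq0 pnatr_eq0 (negbTE sd) orbF.
  rewrite sum_nat_eq0 => /forallP/(_ k1)/eqP dk1.
  by rewrite -(hc0 k1) (gq k1 dk1) fk1 mul0r mulr0.
have nug k : nu k = 0 \/ g k = 0.
  by have /eqP := hc0 k; rewrite c00 mulf_eq0 => /orP[/eqP|/eqP]; [left|right].
have nuf k : nu k != 0 -> evalF (f k) p = 0.
  move=> nk; case: (eqVneq (d k) 0%N) => [dk|dk]; last exact: fk0.
  case: (nug k) => [nk0|]; first by case/negP: nk; rewrite nk0 eqxx.
  rewrite (gq k dk) => /eqP; rewrite mulf_eq0 invr_eq0 (negbTE (mq k dk)) orbF.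
  by move=> /eqP fk; exact: fk.
pose K := [set k | (d k != 0%N) && (nu k != 0)].
have nuK k : d k != 0%N -> nu k = 0.
  move=> dk; apply/eqP; apply: contrapT => /negP nk.
  have kK : k \in K by rewrite inE dk.
  have faceK j : j \in K -> (face j).@[zt] = 0.
    rewrite inE => /andP[_ nj]; case: (nug j) => [nj0|]; first by case/negP: nj; rewrite nj0 eqxx.
    by move/eqP; rewrite mulf_eq0 invr_eq0 (negbTE (mzt _)) orbF => /eqP.
  (* Indices with [d j = 0] drop out because their face functions have zero derivative in the
     variables of positive weight. *)
  have relK i : w i != 0%N ->
      \sum_(j in K) nu j / mon zt (b j) * (mderiv i (face j)).@[zt] = 0.
    move=> wi; apply: (mulfI (zt0' i)); rewrite mulr0 -[RHS](rel i); last by apply/eqP; rewrite qw.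
    rewrite [RHS](bigID (mem K)) /= [X in _ + X]big1 ?addr0 => [|j].
      by rewrite mulr_sumr; apply: eq_bigr => j _; rewrite /h; ring.
    rewrite inE negb_and !negbK => /orP[/eqP dj|/eqP->]; last by rewrite mul0r.
    have [_ [_ _ _ _ h0]] := hb j.
    by rewrite /h h0 // mulr0 mul0r mulr0.
  have exw : exists i, w i != 0%N.
    by have [i wi _] := wdeg_neq0 _ _ dk; exists i.
  pose I := [set i | w i == 0%N].
  suff : nu k / mon zt (b k) = 0.
    by move/eqP; rewrite mulf_eq0 invr_eq0 (negbTE (mzt _)) orbF (negbTE nk).
  (* Without zero weights non-degeneracy applies. Otherwise local tameness does: [zt] agrees with
     [p] on [I], so it lies within the tameness radius, and every [f j] with [d j > 0] vanishes on
     the coordinate space of [I]. *)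
  case: (eqVneq I set0) => [I0|I0].
    have wpos i : w i != 0%N.
      by have := in_set0 i; rewrite -I0 inE => ->.
    exact: (nondegenerate_free p.1 K w zt (fun j => nu j / mon zt (b j)) pd wpos zt0
      faceK (fun i => relK i (wpos i)) k kK).
  apply: (tame_free p.1 K I w zt (fun j => nu j / mon zt (b j)) pd I0 _ exw zt0 _ _ faceK _ k kK).
  - by move=> i; rewrite inE.
  - apply: le_lt_trans pR; rewrite [leRHS](bigID (mem I)) /=.
    rewrite (eq_bigr (fun i => cn2 (p.2 i))) => [|i]; last by rewrite inE wq => /ztq ->.
    by rewrite lerDl sumr_ge0 // => i _; apply: cn2_ge0.
  - move=> j; rewrite inE => /andP[dj _] z hz.
    rewrite mevalE big_seq; apply: big1 => c /msupp_fiberp cj.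
    rewrite -/(mon z c) (vanish c) ?mulr0 //.
      have [[_ _ /(_ c cj) hc] _] := hb j.
      by rewrite -lt0n; apply: leq_trans hc; rewrite lt0n.
    by move=> i wi; apply: hz; rewrite inE.
  - by move=> i; rewrite inE => wi; apply: relK.
(* This undoes the rescaling: for [d k = 0] the monomial tends to a nonzero value at [p], while for
   [d k > 0] the limit [nu k] is already 0. *)
pose nu1 k := if d k == 0%N then nu k / mon p.2 (b k) else 0.
have nu1f k : nu1 k != 0 -> d k = 0%N /\ nu k != 0.
  rewrite /nu1; case: (eqVneq (d k) 0%N) => [dk|_]; last by rewrite eqxx.
  by rewrite mulf_eq0 negb_or => /andP[].
(* For [d k > 0] the term tends to 0, since [mu k * s k] rescaled tends to 0 and [y / s k] has a
   finite limit. *)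
have term (y : nat -> R[i]) (l : R[i]) (k : 'I_k0) : ulim U y l ->
    (exists e, ulim U (fun m => y m / s k m) e) ->
    ulim U (fun m => sg m * (mu k m * y m)) (nu1 k * l).
  move=> yl [e ye]; rewrite /nu1; case: (eqVneq (d k) 0%N) => dk.
    have := ulim_mul uU _ _ _ _ (ulim_div uU _ _ _ _ (mq k dk) (hnu k) (limq k)) yl.
    apply: (ulim_near uU); apply: (ultraS _ uU _ _ sN0) => m /(_ k) sk.
    by field.
  have := ulim_mul uU _ _ _ _ (hnu k) ye; rewrite nuK // !mul0r.
  apply: (ulim_near uU); apply: (ultraS _ uU _ _ sN0) => m /(_ k) sk.
  by field.
have limt : sg0 * a.1 = \sum_k nu1 k * (gradF (f k) p).1.
  apply: (ulim_uniq uU _ _ _ (ulim_mul uU _ _ _ _ hsg at_)).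
  apply: (ulim_ext uU (fun m => \sum_k sg m * (mu k m * (gradF (f k) (x m)).1))).
    by move=> m; rewrite gt mulr_sumr.
  apply: (ulim_sum uU) => k _; apply: term; first exact: ulim_gradF_t.
  by case: (hb k) => _ [].
have limz i : p.2 i != 0 -> sg0 * a.2 i = \sum_k nu1 k * (gradF (f k) p).2 i.
  move=> pi; apply: (ulim_uniq uU _ _ _ (ulim_mul uU _ _ _ _ hsg (az i))).
  apply: (ulim_ext uU (fun m => \sum_k sg m * (mu k m * (gradF (f k) (x m)).2 i))).
    by move=> m; rewrite gz mulr_sumr.
  apply: (ulim_sum uU) => k _; apply: term; first exact: ulim_gradF_z.
  have [_ [_ hh _ _ _]] := hb k; exists (h k i / p.2 i).
  apply: (ulim_near uU _ _ _ _ (ulim_div uU _ _ _ _ pi (hh i) (xz i))).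
  apply: (ultraS2 uU _ _ _ (ulim_neq0 uU _ _ pi (xz i)) sN0) => m xi /(_ k) sk.
  by rewrite -/(s k m); move: (gradF (f k)) => e; field; rewrite xi sk.
case: sgnu => [sg1|[sg1 [k nk]]].
  exists nu1; split=> [k /nu1f[_ /nuf]//| |i pi].
    by rewrite -limt sg1 mul1r.
  by rewrite -limz // sg1 mul1r.
(* If the scale tends to 0, the limit identities become a linear relation between the differentials
   at [p]; [ind] makes it trivial, against [nu k] being nonzero. *)
have : nu1 k = 0.
  apply: ind => [j /nu1f[dj nj]|i pi]; last by rewrite -limz // sg1 mul0r.
  split; first exact: nuf.
  have [[bj _ _] _] := hb j; exists (b j) => // i pi.
  have := wdeg_eq0 w (b j); rewrite -/(d j) dj => /esym/forallP/(_ i).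
  by move/eqP: pi; rewrite qw => /negbTE -> /= /eqP.
have dk : d k = 0%N.
  by apply/eqP; apply: contrapT => /negP/nuK nk0; rewrite nk0 eqxx in nk.
by move/eqP; rewrite /nu1 dk eqxx mulf_eq0 invr_eq0 (negbTE nk) (negbTE (mq k dk)).
Qed.
End Family.

(** * The Thom condition *)

Lemma cn2_le_dist2 {R : realType} {n} (x y : pt R n) :
  cn2 (x.1 - y.1) <= dist2 x y /\ forall i, cn2 (x.2 i - y.2 i) <= dist2 x y.
Proof.
have e : dist2 x y = norm2 (pt_sub x y) by rewrite norm2E.
by rewrite e; exact: (cn2_le_norm2 (pt_sub x y)).
Qed.

Lemma cvg_pt_ulim {R : realType} {n} {U : (nat -> Prop) -> Prop} (uU : ultra U)
    (x : nat -> pt R n) (p : pt R n) : cvg_pt x p ->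
  ulim U (fun m => (x m).1) p.1 /\ forall i, ulim U (fun m => (x m).2 i) (p.2 i).
Proof.
move=> xp; have near e : 0 < e -> U (fun m => dist2 (x m) p < e).
  by move=> /xp[N hN]; apply: (ultraS _ uU _ _ (ultra_ge _ uU N)).
split=> [|i] e e0; apply: (ultraS _ uU _ _ (near e e0)) => m.
  exact: le_lt_trans (cn2_le_dist2 _ _).1.
exact: le_lt_trans ((cn2_le_dist2 _ _).2 i).
Qed.

(** Each coordinate or factor that is zero at [p] is zero on the whole stratum, so its secant
    quotients are all 0 and so is their limit. *)
Lemma tangent_space_conormal {R : realType} {n k0 : nat}
    (f : 'I_k0 -> {mpoly {poly R[i]}[n]}) (I : {set 'I_n}) (K : {set 'I_k0})
    (Q : pt R n -> Prop) (p v : pt R n) :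
  stratum f I K p -> tangent_space (fun y => stratum f I K y /\ Q y) p v ->
  (forall i, p.2 i = 0 -> v.2 i = 0) /\
  (forall k, evalF (f k) p = 0 -> pt_pair (gradF (f k) p) v = 0).
Proof.
move=> [pI pK] [y [c [yS [yp cv]]]].
have [U uU] := ultra_exists.
have [yt yz] := cvg_pt_ulim uU _ _ yp; have [vt vz] := cvg_pt_ulim uU _ _ cv.
split=> [i pi|k fk].
  apply: (ulim_uniq uU _ _ _ (vz i)); apply: (ulim_ext uU _ _ _ _ (ulim_cst uU 0)) => m.
  have [[yI _] _] := yS m.
  by rewrite /= pi (yI i).2 ?subrr ?mulr0 //; exact/(pI i).1.
apply: (ulim_uniq uU _ _ _ (ulim_secant uU _ _ yt yz (f k) _ _ vt vz)).
apply: (ulim_ext uU _ _ _ _ (ulim_cst uU 0)) => m; have [[_ yK] _] := yS m.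
by rewrite fk (yK k).2 ?subrr ?mulr0 //; exact/(pK k).1.
Qed.

Theorem theorem4p1 (R : realType) (n k0 : nat)
  (f : 'I_k0 -> {mpoly {poly R[i]}[n]})
  (hk0 : (0 < k0)%N)
  (hnc : forall k : 'I_k0, forall c : R[i], f k <> (c%:P)%:MP)
  (h0 : forall (k : 'I_k0) (t : R[i]), evalF (f k) (t, fun _ => 0) = 0)
  (hadm : newton_admissible f) :
  let F := \prod_(k < k0) f k in
  exists eps : R, 0 < eps /\
    forall (I : {set 'I_n}) (K : {set 'I_k0}), K != set0 ->
    forall p : pt R n, stratum f I K p -> norm2 p < eps ->
    forall x : nat -> pt R n,
      (forall m, evalF F (x m) <> 0) ->
      (forall m, norm2 (x m) < eps) ->
      cvg_pt x p ->
      forall T : pt R n -> Prop, level_tangents_cvg F x T ->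
      forall v : pt R n,
        tangent_space (fun y => stratum f I K y /\ norm2 y < eps) p v -> T v.
Proof.
move=> F; have [Rr [Rr0 [delta [d0 [fnb fadm]]]]] := hadm.
have f0 k : f k != 0.
  by apply/eqP => fk; apply: (hnc k 0); rewrite fk polyC0 mpolyC0.
have [eps1 [e10 indep]] := coord_independent f Rr delta d0 f0 fnb fadm.
(* The three bounds ensure independence of the differentials at [p], admissibility at the parameter
   of [p], and that [p] lies within the tameness radius. *)
exists (Num.min eps1 (Num.min delta Rr)); split; first by rewrite !lt_min e10 d0.
move=> I K /set0Pn[k1 k1K] p pS; rewrite !lt_min => /and3P[pe pd pR].
move=> x Fx _ xp T [a [_ [[lam la] Ta]]] v vS.
have [U uU] := ultra_exists.
have [xt xz] := cvg_pt_ulim uU _ _ xp; have [at_ az] := cvg_pt_ulim uU _ _ la.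
have pd' : cn2 p.1 < delta by exact: le_lt_trans (cn2_le_norm2 p).1 pd.
have pR' : \sum_i cn2 (p.2 i) < Rr.
  by apply: le_lt_trans pR; rewrite norm2E lerDr cn2_ge0.
have Fx' m : evalF F (x m) != 0 by apply/eqP.
have fk1 : evalF (f k1) p = 0 by case: pS => _ /(_ k1)[_]; exact.
have [nu [nuf nut nuz]] := conormal_limit f Rr delta d0 f0 fnb fadm uU x p lam a
  pd' pR' (indep p pe) xt xz Fx' at_ az k1 fk1.
have [v0 vf] := tangent_space_conormal f I K _ p v pS vS.
apply/(Ta v).2.
(* In directions with [p.2 i = 0] the vector [v] vanishes; in the others [a] equals the combination
   of differentials. *)
transitivity (\sum_k nu k * pt_pair (gradF (f k) p) v).
  rewrite /pt_pair; under [RHS]eq_bigr => k _ do rewrite mulrDr.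
  rewrite big_split /= nut mulr_suml; congr (_ + _).
    by apply: eq_bigr => k _; rewrite mulrA.
  under [RHS]eq_bigr => k _ do rewrite mulr_sumr.
  rewrite exchange_big; apply: eq_bigr => i _ /=.
  case: (eqVneq (p.2 i) 0) => [/v0 ->|/nuz ->].
    by rewrite mulr0 big1 // => k _; rewrite !mulr0.
  by rewrite mulr_suml; apply: eq_bigr => k _; rewrite mulrA.
apply: big1 => k _; case: (eqVneq (nu k) 0) => [->|/nuf/vf ->].
  by rewrite mul0r.
by rewrite mulr0.
Qed.
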